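(* Let $P\subset N_{\mathbb{Q}}$ be a Fano $n$-simplex and let $w\in M$ be a primitive height function. Let the vertices of $P$ be $\{v_0,v_1,\ldots,v_n\}$, ordered such that $w_{h_{\min}}(P)=\mathrm{conv}\{v_1,\ldots,v_k\}$. There exists a factor $F\subset N_{\mathbb{Q}}$ of $P$ with respect to $w$ such that $Q:=\mathrm{mut}_w(P,F)$ is a simplex if and only if the following hold: (i) $w_{h_{\max}}(P)$ is a vertex; (ii) $h_{\min}\mid v_i-v_1$ for $i\in\{1,\ldots,k\}$ (that is, $v_i-v_1\in h_{\min}N$); (iii) if $v$ is a vertex of $P$ such that $w(v)\ne h_{\max}$ and $w(v)\ne h_{\min}$, then $w(v)=0$.
   Context: $N\cong\mathbb{Z}^n$ is a lattice, $M=\mathrm{Hom}(N,\mathbb{Z})$, $N_{\mathbb{Q}}=N\otimes_{\mathbb{Z}}\mathbb{Q}$. A convex lattice polytope $P\subset N_{\mathbb{Q}}$ is Fano if $\dim P=n$, the origin lies in the strict interior of $P$, and the vertices of $P$ are primitive lattice points. A Fano $n$-simplex is a Fano polytope with $n+1$ vertices. A primitive height function is a primitive element $w\in M$, extended to $N_{\mathbb{Q}}\to\mathbb{Q}$. Put $H_{w,h}=\{v\in N_{\mathbb{Q}}: w(v)=h\}$, $w_h(P)=\mathrm{conv}(H_{w,h}\cap P\cap N)$ (possibly empty), $h_{\min}=\min\{w(v):v\in P\}$, $h_{\max}=\max\{w(v):v\in P\}$. A factor of $P$ with respect to $w$ is a lattice polytope $F\subset N_{\mathbb{Q}}$ with $w(F)=0$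 such that for every integer $h$ with $h_{\min}\le h<0$ there is a (possibly empty) lattice polytope $G_h\subset N_{\mathbb{Q}}$ with $H_{w,h}\cap\mathrm{vert}(P)\subseteq G_h+(-h)F\subseteq w_h(P)$, where $\mathrm{vert}(P)$ is the set of vertices of $P$. The mutation of $P$ with respect to $w$ and $F$ is \[\mathrm{mut}_w(P,F)=\mathrm{conv}\Big(\bigcup_{h=h_{\min}}^{-1}G_h\cup\bigcup_{h=0}^{h_{\max}}\big(w_h(P)+hF\big)\Big),\] which is known to be independent of the choice of the $G_h$.
   Formalization: As stated the ''only if'' fails, since F={0} is always a factor with mut_w(P,F)=P; the formal equivalence requires F not to be a point and adds k≥2 to (i)–(iii); the literal ''if'' is kept for every k. *)

(* Defs.v *)
From mathcomp Require Import all_boot all_order all_algebra.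
From mathcomp Require Import all_classical.
Set Implicit Arguments.
Unset Strict Implicit.
Unset Printing Implicit Defensive.
Import Order.TTheory GRing.Theory Num.Theory.
Local Open Scope classical_set_scope.
Local Open Scope ring_scope.

(* Coordinates are fixed throughout: N = 'rV[int]_n, M = Hom(N, Z) =
   'cV[int]_n acting by v |-> v *m w, and N_Q = 'rV[rat]_n. *)

(* 0 = 0 *~ 2 is not primitive. *)
Definition primitive (V : zmodType) (v : V) : Prop :=
  forall (c : int) (u : V), v = u *~ c -> `|c| = 1.

Definition embed n (z : 'rV[int]_n) : 'rV[rat]_n := map_mx intr z.

Definition lattice n : set 'rV[rat]_n := range (@embed n).

Definition height n (w : 'cV[int]_n) (x : 'rV[rat]_n) : rat :=
  (x *m map_mx intr w) 0 0.

Definition conv n (S : set 'rV[rat]_n) : set 'rV[rat]_n :=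
  [set x | exists (m : nat) (p : 'I_m -> 'rV[rat]_n) (a : 'I_m -> rat),
     [/\ forall i, S (p i), forall i, 0 <= a i, \sum_i a i = 1
       & x = \sum_i a i *: p i]].

(* The empty set is allowed (s = [::]). *)
Definition lattice_polytope n (P : set 'rV[rat]_n) : Prop :=
  exists s : seq 'rV[int]_n, P = conv [set embed z | z in [set` s]].

Definition vert n (P : set 'rV[rat]_n) : set 'rV[rat]_n :=
  [set v | P v /\ forall (x y : 'rV[rat]_n) (t : rat),
     P x -> P y -> 0 < t < 1 -> v = t *: x + (1 - t) *: y -> x = y].

Definition aff_indep n m (p : 'I_m -> 'rV[rat]_n) : Prop :=
  forall a : 'I_m -> rat,
    \sum_i a i = 0 -> \sum_i a i *: p i = 0 -> forall i, a i = 0.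

Definition full_dim n (P : set 'rV[rat]_n) : Prop :=
  exists p : 'I_n.+1 -> 'rV[rat]_n, (forall i, P (p i)) /\ aff_indep p.

Definition origin_interior n (P : set 'rV[rat]_n) : Prop :=
  exists2 e : rat, 0 < e & forall x : 'rV[rat]_n, (forall j, `|x 0 j| < e) -> P x.

Definition simplex n (Q : set 'rV[rat]_n) : Prop :=
  exists (m : nat) (p : 'I_m.+1 -> 'rV[rat]_n),
    aff_indep p /\ Q = conv (range p).

Definition fano n (P : set 'rV[rat]_n) : Prop :=
  [/\ lattice_polytope P, full_dim P, origin_interior P
    & forall v, vert P v -> exists2 z, primitive z & v = embed z].

Definition fano_simplex n (P : set 'rV[rat]_n) : Prop :=
  fano P /\ (vert P #= `I_n.+1)%card.

Section Mutation.
Variables (n : nat) (w : 'cV[int]_n).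
Implicit Types P F : set 'rV[rat]_n.

Definition hyperplane (h : int) : set 'rV[rat]_n :=
  [set x | height w x = h%:~R].

(* A linear form with integer coefficients attains its extrema over a nonempty
   lattice polytope at vertices, so they are integers.  The value is 0 if there
   is no integral extremum. *)
Definition h_min P : int :=
  xget 0 [set h : int | (P `&` hyperplane h !=set0)
                        /\ forall x, P x -> h%:~R <= height w x].

Definition h_max P : int :=
  xget 0 [set h : int | (P `&` hyperplane h !=set0)
                        /\ forall x, P x -> height w x <= h%:~R].

Definition slice P (h : int) : set 'rV[rat]_n :=
  conv (hyperplane h `&` P `&` @lattice n).

(* A + h B *)
Definition add_dilate (A : set 'rV[rat]_n) (h : int) (B : set 'rV[rat]_n) :
    set 'rV[rat]_n :=
  [set a + h%:~R *: b | a in A & b in B].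

Definition complement P F (h : int) : set (set 'rV[rat]_n) :=
  [set G | [/\ lattice_polytope G,
               hyperplane h `&` vert P `<=` add_dilate G (- h) F
             & add_dilate G (- h) F `<=` slice P h]].

Definition is_factor P F : Prop :=
  [/\ lattice_polytope F, forall x, F x -> height w x = 0
    & forall h : int, h_min P <= h < 0 -> exists G, complement P F h G].

(* The mutation does not depend on the G_h, so arbitrary ones are chosen; for
   a factor F the default set0 is never used. *)
Definition mut P F : set 'rV[rat]_n :=
  conv (\bigcup_(h in [set h : int | h_min P <= h < 0])
          xget set0 (complement P F h)
        `|` \bigcup_(h in [set h : int | 0 <= h <= h_max P])
              add_dilate (slice P h) h F).

End Mutation.

(* dim F > 0.  If F is a point then mut w P F is the image of P under the shear
   x |-> x + w(x) F, hence a simplex whenever P is. *)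
Definition nontrivial n (F : set 'rV[rat]_n) : Prop :=
  exists f g, [/\ F f, F g & f <> g].

Definition lattice_dvd n (d : int) (x : 'rV[rat]_n) : Prop :=
  exists z : 'rV[int]_n, x = embed (z *~ d).

(* Main.v *)
(* Write m = - h_min and M = h_max, and let K be the set of bottom vertices of P.

   If (i)-(iii) hold and u is the top vertex, take F to be the convex hull of the
   points f_i = (v_i - v_1) / m for i in K.  Then G_{-m} = {v_1}, and the mutation
   is the simplex spanned by v_1, by u + M f_i for i in K, and by the vertices of
   height 0.

   Conversely, write each bottom vertex as v_i = g_i + m f_i with g_i in G_{-m}
   and f_i in F.  In barycentric coordinates g_i + m f_j lies on the edge
   [v_i, v_j], so f_j - f_i and g_j - g_i are both nonnegative multiples of
   v_j - v_i.  The points g_i and v_j + w(v_j) f_i, for w(v_j) > 0, are vertices of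
   the mutation, and a simplex has no two distinct parallel edges pointing in the
   same direction.  Hence f_i = f_j or g_i = g_j for all i, j; as F is not a point,
   all the g_i coincide, which gives (ii).  The same argument leaves only one
   vertex of positive height.  A vertex v = g + |h| f of height h strictly between
   -m and 0 is excluded because v + |h| (f_i - f) cannot lie in P for all i. *)
Require Import Defs.
From mathcomp Require Import all_boot all_order all_algebra.
From mathcomp Require Import all_classical.
From mathcomp Require Import ring lra.
Set Implicit Arguments.
Unset Strict Implicit.
Unset Printing Implicit Defensive.
Import Order.TTheory GRing.Theory Num.Theory.
Local Open Scope classical_set_scope.
Local Open Scope ring_scope.

(** * Convex hulls and barycentric coordinates *)

Section Convexity.
Variable n : nat.
Implicit Types (S C D : set 'rV[rat]_n) (x y z : 'rV[rat]_n).

Definition convex C : Prop :=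
  forall x y (t : rat), C x -> C y -> 0 <= t <= 1 -> C (t *: x + (1 - t) *: y).

(** Induction on the number of points: the last one is split off, and the others, rescaled by their
    total weight [s], give a point of [C]. *)
Lemma conv_min S C : convex C -> S `<=` C -> conv S `<=` C.
Proof.
move=> cC SC x [m [p [a [Sp]]]].
elim: m p a x Sp => [|m IH] p a x Sp a_ge0.
  by rewrite big_ord0 => /esym/eqP; rewrite oner_eq0.
rewrite !big_ord_recr /=; set s := \sum_(i < m) _ => s1 ->.
have s_ge0 : 0 <= s by apply: sumr_ge0.
have [s0|s_neq0] := eqVneq s 0.
  have a0 i : a (widen_ord (leqnSn m) i) = 0.
    exact: (psumr_eq0P _ s0).
  rewrite big1 ?add0r; last by move=> i _; rewrite a0 scale0r.
  have -> : a ord_max = 1 by rewrite -s1 s0 add0r.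
  by rewrite scale1r; apply/SC.
have -> : \sum_(i < m) a (widen_ord (leqnSn m) i) *: p (widen_ord (leqnSn m) i)
   = s *: \sum_(i < m) (a (widen_ord (leqnSn m) i) / s) *:
             p (widen_ord (leqnSn m) i).
  by rewrite scaler_sumr; apply: eq_bigr => i _; rewrite scalerA mulrC divfK.
have -> : a ord_max = 1 - s by rewrite -s1 [_ + a _]addrC addrK.
apply: cC; last 1 first.
- by rewrite s_ge0 -s1 lerDl a_ge0.
- apply: (IH (p \o widen_ord (leqnSn m)) (fun i => a (widen_ord _ i) / s)).
  + by move=> i; apply: Sp.
  + by move=> i; rewrite divr_ge0.
  + by rewrite -mulr_suml divff.
  + by [].
- exact/SC/Sp.
Qed.

(** Indices of weight zero may carry points outside [S]; only the remaining ones are enumerated. *)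
Lemma conv_sum (I : finType) (p : I -> 'rV[rat]_n) (a : I -> rat) S :
  (forall i, 0 <= a i) -> \sum_i a i = 1 -> (forall i, a i != 0 -> S (p i)) ->
  conv S (\sum_i a i *: p i).
Proof.
move=> a_ge0 a1 Sp; exists #|[pred i | a i != 0]|,
  (p \o enum_val), (a \o enum_val); split=> /=.
- by move=> i; apply: Sp; exact: (enum_valP i).
- by move=> i; apply: a_ge0.
- rewrite -(big_enum_val (fun i => a i)) -[RHS]a1.
  rewrite [RHS](bigID (mem [pred i | a i != 0])) /=.
  by rewrite [X in _ = _ + X]big1 ?addr0 // => i; rewrite negbK => /eqP.
- rewrite -(big_enum_val (fun i => a i *: p i)).
  rewrite [LHS](bigID (mem [pred i | a i != 0])) /=.
  rewrite [X in _ + X]big1 ?addr0 // => i; rewrite negbK => /eqP ->.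
  by rewrite scale0r.
Qed.

Lemma sub_conv S : S `<=` conv S.
Proof.
move=> x Sx; exists 1%N, (fun=> x), (fun=> 1).
by rewrite !big_ord1 scale1r.
Qed.

Lemma conv_convex S : convex (conv S).
Proof.
move=> _ _ t [m [p [a [Sp a_ge0 a1 ->]]]] [m' [p' [a' [Sp' a'_ge0 a'1 ->]]]].
case/andP=> t0 t1.
pose q (i : 'I_m + 'I_m') := match i with inl i => p i | inr i => p' i end.
pose c (i : 'I_m + 'I_m') :=
  match i with inl i => t * a i | inr i => (1 - t) * a' i end.
have -> : t *: (\sum_i a i *: p i) + (1 - t) *: (\sum_i a' i *: p' i)
    = \sum_i c i *: q i.
  rewrite big_sumType /= !scaler_sumr.
  by congr (_ + _); apply: eq_bigr => i _; rewrite scalerA.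
apply: conv_sum.
- by case=> i /=; rewrite mulr_ge0 ?subr_ge0.
- by rewrite big_sumType /= -!mulr_sumr a1 a'1 !mulr1 addrC subrK.
- by case=> i /= _.
Qed.

Lemma conv_mono S C : S `<=` C -> conv S `<=` conv C.
Proof.
move=> SC; apply: conv_min; first exact: conv_convex.
exact: subset_trans SC (@sub_conv C).
Qed.

Lemma conv0 : conv (@set0 'rV[rat]_n) = set0.
Proof. by rewrite -subset0; apply: conv_min => // x y t []. Qed.

Lemma conv1 x : conv [set x] = [set x].
Proof.
apply/seteqP; split; last exact: sub_conv.
apply: conv_min => // _ _ t -> -> _ /=.
by rewrite -scalerDl addrC subrK scale1r.
Qed.

Lemma convex_preimage (c : rat) x C :
  convex C -> convex [set y | C (x + c *: y)].
Proof.
move=> cC y z t /= Cy Cz t01.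
have := cC _ _ _ Cy Cz t01; congr C.
rewrite !scalerDr addrACA -scalerDl [t + _]addrC subrK scale1r.
by rewrite !scalerA ![c * _]mulrC.
Qed.

(** Isolate a point [p i] of positive weight. If that weight is below 1, then [x] lies strictly
    between [p i] and a point of the hull, and extremality makes all three equal. *)
Lemma vert_conv S x : vert (conv S) x -> S x.
Proof.
case=> [[m [p [a [Sp a_ge0 a1 x_def]]]] x_ext].
have /existsP[i ai] : [exists i, 0 < a i].
  apply: contraT; rewrite negb_exists => /forallP a_le0.
  move: a1; rewrite big1 => [/esym/eqP|i _]; first by rewrite oner_eq0.
  by apply/eqP; rewrite eq_le a_ge0 leNgt a_le0.
have [ai1|ai_neq1] := eqVneq (a i) 1.
  have a0 j : j != i -> a j = 0.
    move: a1; rewrite (bigD1 i) //= ai1 -[RHS]addr0 => /addrI /psumr_eq0P.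
    by apply.
  suff -> : x = p i by apply: Sp.
  rewrite x_def (bigD1 i) //= ai1 scale1r big1 ?addr0 // => j ji.
  by rewrite a0 // scale0r.
have a1' : \sum_(j | j != i) a j = 1 - a i.
  by rewrite -a1 [X in _ = X - _](bigD1 i) //= addrAC subrr add0r.
have ai_lt1 : a i < 1.
  by rewrite lt_neqAle ai_neq1 -subr_ge0 -a1' sumr_ge0.
pose y := \sum_j (if j == i then 0 else a j / (1 - a i)) *: p j.
have ne0 : 1 - a i != 0 by rewrite subr_eq0 eq_sym.
have xE : x = a i *: p i + (1 - a i) *: y.
  rewrite x_def (bigD1 i) //=; congr (_ + _).
  rewrite /y [in RHS](bigD1 i) //= eqxx scale0r add0r scaler_sumr.
  apply: eq_bigr => j /negPf ->.
  by rewrite scalerA mulrC divfK.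
have Cy : conv S y.
  apply: conv_sum => [j||j _]; last exact: Sp.
  - by case: eqP => // _; rewrite divr_ge0 // subr_ge0 ltW.
  - rewrite (bigD1 i) //= eqxx add0r.
    rewrite (eq_bigr (fun j => a j / (1 - a i))); last by move=> j /negPf ->.
    by rewrite -mulr_suml a1' divff.
have py : p i = y.
  apply: (x_ext _ _ (a i)) => //; last by rewrite ai ai_lt1.
  exact/sub_conv/Sp.
suff -> : x = p i by apply: Sp.
by rewrite xE -py -scalerDl addrC subrK scale1r.
Qed.

(** The weights live on all of [I] and vanish off [A], so that two points of the hull can be
    combined index by index. *)
Lemma convP (I : finType) (A : {pred I}) (p : I -> 'rV[rat]_n) x :
  conv (p @` [set` A]) x <->
  exists a : I -> rat, [/\ forall i, 0 <= a i, forall i, i \notin A -> a i = 0,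
    \sum_i a i = 1 & x = \sum_i a i *: p i].
Proof.
split=> [|[a [a_ge0 a0 a1 ->]]]; last first.
  apply: conv_sum => // i ai; exists i => //=.
  by apply: contraR ai => /a0 ->.
move: x; apply: conv_min => [_ _ t [a [a_ge0 a0 a1 ->]] [c [c_ge0 c0 c1 ->]]|].
  case/andP=> t0 t1; exists (fun i => t * a i + (1 - t) * c i); split.
  - by move=> i; rewrite addr_ge0 // mulr_ge0 // subr_ge0.
  - by move=> i Ai; rewrite a0 // c0 // !mulr0 addr0.
  - by rewrite big_split /= -!mulr_sumr a1 c1 !mulr1 addrC subrK.
  - rewrite !scaler_sumr -big_split /=; apply: eq_bigr => i _.
    by rewrite !scalerA -scalerDl.
move=> _ [i /= Ai <-]; exists (fun j => (j == i)%:R); split.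
- by move=> j; rewrite ler0n.
- by move=> j Aj; case: eqP Aj => // ->; rewrite Ai.
- by rewrite (bigD1 i) //= eqxx big1 ?addr0 // => j /negPf ->.
- rewrite (bigD1 i) //= eqxx scale1r big1 ?addr0 // => j /negPf ->.
  by rewrite scale0r.
Qed.

Lemma conv_vert (I : finType) (A : {set I}) (p : I -> 'rV[rat]_n) :
  conv (p @` [set` A]) = conv (vert (conv (p @` [set` A]))).
Proof.
elim: {A}_.+1 {-2}A (ltnSn #|A|) => // N IH A; rewrite ltnS => AN.
apply/seteqP; split; last by apply: conv_min; [exact: conv_convex|move=> x []].
have [A_vert|] := pselect (p @` [set` A] `<=` vert (conv (p @` [set` A]))).
  exact: conv_mono.
move=> /existsNP[_ /not_implyP[[i /= Ai <-] not_vert]].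
suff eqA : conv (p @` [set` A]) = conv (p @` [set` A :\ i]).
  have lt_N : (#|A :\ i| < N)%N by move: AN; rewrite (cardsD1 i) Ai.
  by rewrite eqA {1}(IH _ lt_N).
apply/seteqP; split; last first.
  apply: conv_mono => _ [j /= jA <-]; exists j => //=.
  by move: jA; rewrite in_setD1 => /andP[].
apply: conv_min; first exact: conv_convex.
suff : conv (p @` [set` A :\ i]) (p i).
  move=> ci _ [j /= Aj <-]; have [->//|ji] := eqVneq j i.
  by apply: sub_conv; exists j => //=; rewrite in_setD1 ji.
apply: contrapT => not_ci; apply: not_vert; split.
  by apply: sub_conv; exists i.
move=> x y t /convP[a [a_ge0 a0 a1 x_def]] /convP[c [c_ge0 c0 c1 y_def]].
case/andP=> t0 t1 pi_def.
pose d j := t * a j + (1 - t) * c j.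
have t1' : 0 < 1 - t by rewrite subr_gt0.
have d_ge0 j : 0 <= d j.
  by rewrite addr_ge0 // mulr_ge0 // ltW.
have d1 : \sum_j d j = 1.
  by rewrite big_split /= -!mulr_sumr a1 c1 !mulr1 addrC subrK.
have pid : p i = \sum_j d j *: p j.
  rewrite {1}pi_def x_def y_def !scaler_sumr -big_split /=.
  by apply: eq_bigr => j _; rewrite !scalerA -scalerDl.
have d1' : \sum_(j | j != i) d j = 1 - d i.
  by rewrite -d1 [X in _ = X - _](bigD1 i) //= addrAC subrr add0r.
have [di1|di_neq1] := eqVneq (d i) 1.
  have dj0 j : j != i -> d j = 0.
    move: d1'; rewrite di1 subrr => /psumr_eq0P; exact.
  have aj0 j : j != i -> a j = 0 /\ c j = 0.
    move=> ji; have /eqP := dj0 j ji.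
    rewrite paddr_eq0 ?mulr_ge0 ?(ltW t0) ?(ltW t1') //.
    by rewrite !mulf_eq0 (gt_eqF t0) (gt_eqF t1') /= => /andP[/eqP -> /eqP ->].
  have sum1 (e : I -> rat) : (forall j, j != i -> e j = 0) -> \sum_j e j = 1 ->
      \sum_j e j *: p j = p i.
    move=> e0; rewrite (bigD1 i) //= big1 // addr0 => ei.
    rewrite (bigD1 i) //= ei scale1r big1 ?addr0 // => l /e0 ->.
    by rewrite scale0r.
  by rewrite x_def y_def !sum1 // => k /aj0[].
(* As [d i] is not 1, the relation expressing [p i] through all the [d j *: p j] can be solved for
   [p i]. *)
have ne0 : 1 - d i != 0 by rewrite subr_eq0 eq_sym.
case: not_ci.
have di_lt1 : 0 < 1 - d i.
  by rewrite lt_neqAle eq_sym ne0 -d1' sumr_ge0.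
apply/convP; exists (fun j => if j == i then 0 else d j / (1 - d i)); split.
- by move=> j; case: eqP => // _; rewrite divr_ge0 // ltW.
- move=> j; rewrite in_setD1; case: eqP => //= _ jA.
  by rewrite /d a0 // c0 // !mulr0 addr0 mul0r.
- rewrite (bigD1 i) //= eqxx add0r.
  rewrite (eq_bigr (fun j => d j / (1 - d i))); last by move=> j /negPf ->.
  by rewrite -mulr_suml d1' divff.
- rewrite (bigD1 i) //= eqxx scale0r add0r.
  apply: (scalerI ne0).
  rewrite scalerBl scale1r {1}pid (bigD1 i) //= addrAC subrr add0r scaler_sumr.
  by apply: eq_bigr => j /negPf ->; rewrite scalerA mulrC divfK.
Qed.

(** * Affine functions and faces of a hull *)

Definition affine (l : 'rV[rat]_n -> rat) : Prop :=
  forall (c : rat) x y z, l (x + c *: (y - z)) = l x + c * (l y - l z).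

Lemma affine_sum (I : finType) (l : 'rV[rat]_n -> rat) (a : I -> rat) p :
  affine l -> \sum_i a i = 1 -> l (\sum_i a i *: p i) = \sum_i a i * l (p i).
Proof.
move=> l_aff a1.
suff -> : l (\sum_i a i *: p i) = l 0 + \sum_i a i * (l (p i) - l 0).
  under eq_bigr do rewrite mulrBr.
  by rewrite sumrB -mulr_suml a1 mul1r addrC subrK.
elim/big_rec2: _ => [|i x r _ IH]; first by rewrite addr0.
by rewrite [_ *: _ + _]addrC -{1}[p i]subr0 l_aff IH; ring.
Qed.

Lemma affine_comb (l : 'rV[rat]_n -> rat) (t : rat) x y :
  affine l -> l (t *: x + (1 - t) *: y) = t * l x + (1 - t) * l y.
Proof.
move=> l_aff; rewrite addrC scalerBl scale1r -addrA [- _ + _]addrC.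
by rewrite -scalerBr l_aff; ring.
Qed.

Lemma convex_comb_max (t a b c : rat) : 0 < t < 1 -> a <= c -> b <= c ->
  t * a + (1 - t) * b = c -> a = c /\ b = c.
Proof.
case/andP=> t0 t1 ac bc e.
have : t * (c - a) + (1 - t) * (c - b) = 0.
  by transitivity (c - (t * a + (1 - t) * b)); [ring|rewrite e subrr].
have t1' : 0 < 1 - t by rewrite subr_gt0.
move/eqP; rewrite paddr_eq0 ?mulr_ge0 ?subr_ge0 ?(ltW t0) ?(ltW t1) //.
rewrite !mulf_eq0 (gt_eqF t0) (gt_eqF t1') /= !subr_eq0.
by case/andP=> /eqP -> /eqP ->.
Qed.

Lemma convex_le (l : 'rV[rat]_n -> rat) (c : rat) :
  affine l -> convex [set x | l x <= c].
Proof.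
move=> l_aff x y t /= lx ly /andP[t0 t1]; rewrite affine_comb //.
have : 0 <= t * (c - l x) + (1 - t) * (c - l y).
  by rewrite addr_ge0 // mulr_ge0 // subr_ge0.
lra.
Qed.

Lemma convex_eq (l : 'rV[rat]_n -> rat) (c : rat) :
  affine l -> convex [set x | l x = c].
Proof.
by move=> l_aff x y t /= lx ly _; rewrite affine_comb // lx ly; ring.
Qed.

(* [T] contains the face on which [l] attains its maximum, and an extreme point
   of a face is extreme. *)
Lemma vert_face S (l : 'rV[rat]_n -> rat) (c : rat) T x :
  affine l -> convex T -> (forall y, S y -> l y <= c) ->
  (forall y, S y -> l y = c -> T y) -> S x -> l x = c -> vert T x ->
  vert (conv S) x.
Proof.
move=> l_aff T_cvx S_le S_T Sx lx [_ x_ext].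
have conv_le y : conv S y -> l y <= c.
  by apply: (@conv_min S [set z | l z <= c]); [exact: convex_le|exact: S_le].
(* The bound on [l] together with membership in [T] in the case of equality is a convex condition,
   so it passes from [S] to its hull. *)
have conv_T y : conv S y -> l y = c -> T y.
  move=> Sy ly; suff: [set y | l y <= c /\ (l y = c -> T y)] y.
    by case=> _ h; exact: h.
  move: y Sy {ly}; apply: conv_min => [y z t [ly Ty] [lz Tz] /andP[t0 t1]|y Sy].
    split; first by apply: (convex_le l_aff) => //; rewrite t0.
    rewrite affine_comb // => le.
    have [t_eq0|t_neq0] := eqVneq t 0.
      move: le; rewrite t_eq0 subr0 mul0r add0r mul1r scale0r add0r scale1r.
      exact: Tz.
    have [t_eq1|t_neq1] := eqVneq t 1.
      move: le; rewrite t_eq1 subrr mul0r addr0 mul1r scale0r addr0 scale1r.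
      exact: Ty.
    have tp : 0 < t by rewrite lt_neqAle eq_sym t_neq0.
    have tq : 0 < 1 - t by rewrite subr_gt0 lt_neqAle t_neq1.
    have [|ly_c lz_c] := convex_comb_max _ ly lz le.
      by rewrite tp -subr_gt0.
    by apply: T_cvx; [exact: Ty|exact: Tz|rewrite t0].
  by split; [exact: S_le|exact: S_T].
split; first exact: sub_conv.
move=> y z t Sy Sz t01 xE.
have [|ly lz] := convex_comb_max t01 (conv_le y Sy) (conv_le z Sz).
  by rewrite -affine_comb // -xE.
by apply: (x_ext y z t) => //; exact: conv_T.
Qed.

(** * Affine independence and barycentric coordinates *)

Definition homog m (p : 'I_m -> 'rV[rat]_n) : 'M[rat]_(m, 1 + n) :=
  row_mx (const_mx 1) (\matrix_i p i).

Lemma homog_row m (p : 'I_m -> 'rV[rat]_n) (u : 'rV[rat]_m) :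
  u *m homog p = row_mx (\sum_i u 0 i)%:M (\sum_i u 0 i *: p i).
Proof.
rewrite mul_mx_row; congr row_mx.
  apply/matrixP => i j; rewrite !ord1 !mxE eqxx.
  by apply: eq_bigr => l _; rewrite !mxE mulr1.
by rewrite mulmx_sum_row; apply: eq_bigr => i _; rewrite rowK.
Qed.

(** The affine relations among the [p i] are the linear relations among the rows [(1, p i)], and for
    [n + 1] points this matrix is square. *)
Lemma aff_indepP (p : 'I_n.+1 -> 'rV[rat]_n) :
  aff_indep p <-> (homog p : 'M_n.+1) \in unitmx.
Proof.
rewrite -row_free_unit; split=> [p_ind|p_free a a0 ap0 i].
  apply: inj_row_free => u; rewrite homog_row -(@row_mx0 _ 1 1 n).
  move=> /(@eq_row_mx _ 1 1 n)[/matrixP /(_ 0 0)].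
  rewrite !mxE eqxx mulr1n => u0 up0.
  apply/rowP => i; rewrite row_mx0 mxE; exact: p_ind u0 up0 i.
have : \row_i a i *m homog p = 0.
  rewrite homog_row; under eq_bigr do rewrite mxE.
  under [X in row_mx _ X]eq_bigr do rewrite mxE.
  by rewrite a0 ap0 raddf0 row_mx0.
move/eqP; rewrite mulmx_free_eq0 // => /eqP/rowP/(_ i).
by rewrite !mxE.
Qed.

Definition aff_span m (p : 'I_m -> 'rV[rat]_n) : set 'rV[rat]_n :=
  [set x | exists2 a : 'I_m -> rat, \sum_i a i = 1 & x = \sum_i a i *: p i].

Lemma aff_span_conv m (p : 'I_m -> 'rV[rat]_n) :
  conv (range p) `<=` aff_span p.
Proof.
by move=> x; rewrite -set_true => /convP[a [_ _ a1 ->]]; exists a.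
Qed.

Lemma aff_span_refl m (p : 'I_m -> 'rV[rat]_n) i : aff_span p (p i).
Proof. by apply: aff_span_conv; apply: sub_conv; exists i. Qed.

Lemma aff_span_add m (p : 'I_m -> 'rV[rat]_n) (c : rat) x y z :
  aff_span p x -> aff_span p y -> aff_span p z -> aff_span p (x + c *: (y - z)).
Proof.
move=> [a a1 ->] [b b1 ->] [d d1 ->]; exists (fun i => a i + c * (b i - d i)).
  by rewrite big_split /= -mulr_sumr sumrB a1 b1 d1 subrr mulr0 addr0.
rewrite -sumrB scaler_sumr -big_split /=; apply: eq_bigr => i _.
by rewrite scalerDl -scalerA scalerBl.
Qed.

(** [homog q] is a square matrix times [homog p], so invertibility of the product gives that of
    [homog p]. *)
Lemma aff_indep_span (p q : 'I_n.+1 -> 'rV[rat]_n) :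
  aff_indep q -> (forall i, aff_span p (q i)) -> aff_indep p.
Proof.
rewrite !aff_indepP => q_unit pq.
have {}pq i : exists a : 'rV[rat]_n.+1,
    \sum_j a 0 j = 1 /\ q i = \sum_j a 0 j *: p j.
  have [a a1 ->] := pq i; exists (\row_j a j).
  by split; [rewrite -a1|]; apply: eq_bigr => j _; rewrite mxE.
have [a a_def] := choice pq.
have qE : homog q = (\matrix_i a i) *m homog p.
  apply/row_matrixP => i; rewrite row_mul rowK homog_row.
  have [-> <-] := a_def i; rewrite row_row_mx rowK; congr row_mx.
  by apply/matrixP => j l; rewrite !ord1 !mxE.
by move: q_unit; rewrite qE unitmx_mul => /andP[].
Qed.

(** For affinely independent [p] these are the coordinates of [(1, x)] in the basis of the
    [(1, p i)]. *)
Definition bary (p : 'I_n.+1 -> 'rV[rat]_n) (i : 'I_n.+1) x : rat :=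
  (row_mx 1%:M x *m invmx (homog p : 'M_n.+1)) 0 i.

Lemma bary_affine p i : affine (bary p i).
Proof.
move=> c x y z; rewrite /bary.
have -> : row_mx 1%:M (x + c *: (y - z)) = row_mx 1%:M x +
    c *: (row_mx 1%:M y - row_mx 1%:M z) :> 'rV_(1 + n).
  by rewrite opp_row_mx add_row_mx subrr scale_row_mx scaler0 add_row_mx addr0.
by rewrite mulmxDl -scalemxAl mulmxBl !mxE.
Qed.

Section Barycentric.
Variable p : 'I_n.+1 -> 'rV[rat]_n.
Hypothesis p_ind : aff_indep p.

Lemma bary_eq x : \sum_i bary p i x = 1 /\ \sum_i bary p i x *: p i = x.
Proof.
have := homog_row p (row_mx 1%:M x *m invmx (homog p : 'M_n.+1)).
rewrite mulmxKV; last exact/aff_indepP.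
move=> /eq_row_mx[/matrixP/(_ 0 0)]; rewrite !mxE /= => sum1 sumx.
by split; [symmetry; move: sum1; rewrite !mulr1n|].
Qed.

Lemma bary_sum1 x : \sum_i bary p i x = 1.
Proof. by case: (bary_eq x). Qed.

Lemma bary_sum x : \sum_i bary p i x *: p i = x.
Proof. by case: (bary_eq x). Qed.

Lemma bary_vertex i j : bary p i (p j) = (i == j)%:R.
Proof.
rewrite /bary; have -> : row_mx 1%:M (p j) = row j (homog p : 'M_n.+1).
  rewrite (@row_row_mx _ _ 1 n) rowK; congr row_mx.
  by apply/matrixP => k l; rewrite !ord1 !mxE.
rewrite -row_mul mulmxV; last exact/aff_indepP.
by rewrite !mxE eq_sym.
Qed.

Lemma aff_indep_inj : injective p.
Proof.
move=> i j pij; apply/eqP; have := bary_vertex i j.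
by rewrite -pij bary_vertex eqxx; case: eqP => // _ /eqP; rewrite oner_eq0.
Qed.

Lemma bary_comb (a : 'I_n.+1 -> rat) i :
  \sum_j a j = 1 -> bary p i (\sum_j a j *: p j) = a i.
Proof.
move=> a1; rewrite affine_sum //; last exact: bary_affine.
rewrite (bigD1 i) //= bary_vertex eqxx mulr1 big1 ?addr0 // => j ji.
by rewrite bary_vertex eq_sym (negPf ji) mulr0.
Qed.

(** Reduces identities between coordinate functions to a check at the vertices. *)
Lemma affine_ext (l l' : 'rV[rat]_n -> rat) :
  affine l -> affine l' -> (forall i, l (p i) = l' (p i)) -> l =1 l'.
Proof.
move=> l_aff l'_aff ll' x; rewrite -(bary_sum x).
rewrite !affine_sum ?bary_sum1 //; apply: eq_bigr => i _; by rewrite ll'.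
Qed.

Lemma conv_bary x : conv (range p) x <-> forall i, 0 <= bary p i x.
Proof.
rewrite -set_true; split=> [/convP[a [a_ge0 _ a1 ->]] i|b_ge0].
  by rewrite bary_comb.
by apply/convP; exists (bary p ^~ x); rewrite bary_sum1 bary_sum.
Qed.

Lemma conv_bary_in (A : {pred 'I_n.+1}) x : conv (p @` [set` A]) x <->
  conv (range p) x /\ forall i, i \notin A -> bary p i x = 0.
Proof.
split=> [Ax|[/conv_bary b_ge0 b0]].
  split.
    move: x Ax; apply: conv_mono => _ [i _ <-]; by exists i.
  by have /convP[a [_ a0 a1 ->]] := Ax => i /a0; rewrite bary_comb.
by apply/convP; exists (bary p ^~ x); rewrite bary_sum1 bary_sum.
Qed.

End Barycentric.

(** The four points are among the spanning points, and the equation is an affine relation between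
    them. If [x] and [x'] had different indices, the coefficient at [x] would be 1 or [1 + c], hence
    nonzero. *)
Lemma vert_simplex (Q : set 'rV[rat]_n) (c : rat) x y x' y' :
  simplex Q -> vert Q x -> vert Q y -> vert Q x' -> vert Q y' ->
  0 < c -> x != y -> x - y = c *: (x' - y') -> x = x'.
Proof.
move=> [m [p [p_ind ->]]] /vert_conv[i _ <-] /vert_conv[j _ <-].
move=> /vert_conv[i' _ <-] /vert_conv[j' _ <-] c0 ij e.
have [->//|ii'] := eqVneq i i'.
pose a l : rat := (l == i)%:R - (l == j)%:R - c * ((l == i')%:R - (l == j')%:R).
have sumE (V : lmodType rat) (f : 'I_m.+1 -> V) l :
    \sum_k (k == l)%:R *: f k = f l.
  rewrite (bigD1 l) //= eqxx scale1r big1 ?addr0 // => k /negPf ->.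
  by rewrite scale0r.
have sum1 (l : 'I_m.+1) : \sum_k (k == l)%:R = 1 :> rat.
  rewrite (bigD1 l) //= eqxx big1 ?addr0 // => k /negPf -> //.
have := p_ind a _ _ i; rewrite /a eqxx (negPf ii').
have -> : (i == j) = false by apply: contraNF ij => /eqP ->.
rewrite !sumrB -mulr_sumr sumrB !sum1 !subrr mulr0 subr0 => /(_ erefl).
have -> : \sum_k ((k == i)%:R - (k == j)%:R -
    c * ((k == i')%:R - (k == j')%:R)) *: p k = 0.
  under eq_bigr do rewrite !scalerBl -scalerA scalerBl.
  by rewrite !sumrB -scaler_sumr sumrB !sumE e subrr.
move=> /(_ erefl).
by move=> h; exfalso; move: h; case: (i == j') => /=; lra.
Qed.

End Convexity.

(** * Heights on lattice simplices *)

Section Height.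
Variable n : nat.
Implicit Types (x y : 'rV[rat]_n) (w : 'cV[int]_n).

Lemma heightD w x y : height w (x + y) = height w x + height w y.
Proof. by rewrite /height mulmxDl mxE. Qed.

Lemma heightZ w (c : rat) x : height w (c *: x) = c * height w x.
Proof. by rewrite /height -scalemxAl mxE. Qed.

Lemma heightB w x y : height w (x - y) = height w x - height w y.
Proof. by rewrite heightD -scaleN1r heightZ mulN1r. Qed.

Lemma height_affine w : affine (height w).
Proof. by move=> c x y z; rewrite heightD heightZ heightB. Qed.

Lemma height_embed w (z : 'rV[int]_n) :
  height w (embed z) = ((z *m w) 0 0)%:~R.
Proof. by rewrite /height /embed -map_mxM mxE. Qed.

Lemma embedMz (z : 'rV[int]_n) (c : int) : embed (z *~ c) = c%:~R *: embed z.
Proof. by rewrite scaler_int /embed raddfMz. Qed.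

Lemma embedN (z : 'rV[int]_n) : embed (- z) = - embed z.
Proof. by apply/rowP => i; rewrite !mxE rmorphN. Qed.

Lemma embedB (z y : 'rV[int]_n) : embed (z - y) = embed z - embed y.
Proof. by apply/rowP => i; rewrite !mxE rmorphB. Qed.

Lemma embed0 : embed (0 : 'rV[int]_n) = 0.
Proof. by apply/rowP => i; rewrite !mxE. Qed.

Lemma primitive_neq0 w : primitive w -> w != 0.
Proof.
move=> w_prim; apply/eqP => w0.
by have := w_prim 2 0; rewrite w0 mul0rz => /(_ erefl).
Qed.

Lemma lattice_polytope_image (I : finType) (A : {pred I})
    (z : I -> 'rV[int]_n) :
  lattice_polytope (conv ((fun i => embed (z i)) @` [set` A])).
Proof.
exists [seq z i | i in A]; congr conv; apply/seteqP; split.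
  move=> _ [i /= Ai <-]; exists (z i) => //=.
  exact: fintype.image_f.
by move=> _ [_ /= /fintype.imageP[i Ai ->] <-]; exists i.
Qed.

Lemma lattice_polytope_convex (C : set 'rV[rat]_n) :
  lattice_polytope C -> convex C.
Proof. by move=> [s ->]; exact: conv_convex. Qed.

Lemma origin_interior_height (P : set 'rV[rat]_n) w (s : rat) :
  origin_interior P -> w != 0 -> s != 0 ->
  exists2 x, P x & 0 < s * height w x.
Proof.
move=> [e e0 eP] w0 s0.
have [i wi] : exists i, w i 0 != 0.
  apply/existsP; apply: contraNT w0; rewrite negb_exists => /forallP wi0.
  by apply/eqP/colP => i; rewrite mxE; apply/eqP; rewrite -[_ == _]negbK wi0.
(* A multiple of a basis vector on which [w] is nonzero: [e / 2] keeps it inside [P], and the sign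
   makes [s] times its height positive. *)
pose c : rat := e / 2 * Num.sg (s * (w i 0)%:~R).
have si0 : s * (w i 0)%:~R != 0 :> rat by rewrite mulf_neq0 // intr_eq0.
exists (c *: delta_mx 0 i).
  apply: eP => j; rewrite !mxE normrM normrM normr_sg si0 mulr1.
  rewrite [`|e / 2|]ger0_norm; last by rewrite divr_ge0 // ltW.
  by case: (j == i); rewrite ?andbF ?andbT /= ?normr0 ?normr1; lra.
rewrite heightZ.
have -> : height w (delta_mx 0 i) = (w i 0)%:~R.
  by rewrite /height -rowE !mxE.
have -> : s * (c * (w i 0)%:~R) = e / 2 * `|s * (w i 0)%:~R|.
  by rewrite normrEsg /c; ring.
by rewrite mulr_gt0 ?normr_gt0 // divr_gt0.
Qed.

(** Independence follows by counting: the affine span of the [n + 1] vertices contains [P], hence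
    [n + 1] affinely independent points. *)
Lemma fano_simplexP (P : set 'rV[rat]_n) (v : 'I_n.+1 -> 'rV[rat]_n) :
  fano_simplex P -> vert P = range v ->
  [/\ P = conv (range v), aff_indep v & exists z, forall i, v i = embed (z i)].
Proof.
move=> [[[s s_def] [q [Pq q_ind]] _ P_prim] _] vertP.
have PE : P = conv (range v).
  rewrite -vertP.
  have {s_def} -> : P = conv ((fun i : seq_sub s => embed (ssval i)) @`
     [set` [set: seq_sub s]%SET]).
    rewrite s_def; congr conv; apply/seteqP; split.
      move=> _ [z /= sz <-]; exists (SeqSub sz) => //=; exact: finset.in_setT.
    by move=> _ [i _ <-]; exists (ssval i) => //=; apply: ssvalP.
  exact: conv_vert.
split=> //.
  by apply: (aff_indep_span q_ind) => i; apply: aff_span_conv; rewrite -PE.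
have v_int i : exists z, v i = embed z.
  by have [|z _ ->] := P_prim (v i); [rewrite vertP; exists i|exists z].
by have [z zE] := choice v_int; exists z.
Qed.

End Height.

(** * Extremal heights and slices of a lattice simplex *)

Section LatticeSimplex.
Variables (n : nat) (P : set 'rV[rat]_n) (w : 'cV[int]_n).
Variables (v : 'I_n.+1 -> 'rV[rat]_n) (z : 'I_n.+1 -> 'rV[int]_n).
Hypotheses (v_ind : aff_indep v) (PE : P = conv (range v)).
Hypotheses (vertP : vert P = range v) (v_int : forall i, v i = embed (z i)).
Hypotheses (w_neg : exists2 x, P x & height w x < 0).
Hypotheses (w_pos : exists2 x, P x & 0 < height w x).

Definition vheight i : int := (z i *m w) 0 0.
Local Notation lo := (h_min w P).
Local Notation hi := (h_max w P).
Local Notation b := (bary v).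

Lemma height_vertex i : height w (v i) = (vheight i)%:~R.
Proof. by rewrite v_int height_embed. Qed.

Lemma vertex_in i : P (v i).
Proof. by rewrite PE; apply: sub_conv; exists i. Qed.

Lemma inP x : P x <-> forall i, 0 <= b i x.
Proof. by rewrite PE; apply: conv_bary. Qed.

Lemma convexP : convex P.
Proof. by rewrite PE; apply: conv_convex. Qed.

(** The other coordinates are nonnegative and their sum is at most 0. This is how points are
    recognised as vertices below. *)
Lemma bary_ge1 i x : P x -> 1 <= b i x -> x = v i.
Proof.
move=> /inP b_ge0 b1; rewrite -(bary_sum v_ind x).
have b_sum := bary_sum1 v_ind x; rewrite (bigD1 i) //= in b_sum.
have rest_ge0 : 0 <= \sum_(j | j != i) b j x by apply: sumr_ge0.
have bi1 : b i x = 1 by apply/eqP; rewrite eq_le b1 andbT; lra.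
have /psumr_eq0P b0 : \sum_(j | j != i) b j x = 0 by lra.
rewrite (bigD1 i) //= bi1 scale1r big1 ?addr0 // => j ji.
by rewrite b0 // scale0r.
Qed.

Lemma h_min_vertex : (exists i, vheight i = lo) /\ forall i, lo <= vheight i.
Proof.
pose i0 := [arg min_(i < ord0 | true) vheight i]%O.
have le_hz i : vheight i0 <= vheight i.
  by rewrite /i0; case: arg_minP => // j _; apply.
have le_height x : P x -> (vheight i0)%:~R <= height w x.
  rewrite PE => Px.
  suff: - height w x <= - (vheight i0)%:~R by rewrite lerN2.
  have aff : affine (fun x => - height w x).
    by move=> c y y' y''; rewrite height_affine; ring.
  move: x Px.
  apply: (@conv_min _ _ [set x | - height w x <= - (vheight i0)%:~R]).
    exact: convex_le.
  by move=> _ [i _ <-] /=; rewrite height_vertex lerN2 ler_int.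
suff -> : lo = vheight i0 by split=> //; exists i0.
(* Two attained integral lower bounds coincide, so [xget] returns [vheight i0] and not its
   default. *)
apply: xget_subset1 => /=.
  split=> //; exists (v i0); split; [exact: vertex_in|exact: height_vertex].
move=> h h' [[x [Px xh]] hle] [[x' [Px' xh']] h'le].
apply/eqP; rewrite eq_le -(ler_int rat) -[_ <= h](ler_int rat).
by rewrite -{2}xh -{1}xh' hle // h'le.
Qed.

Lemma h_max_vertex : (exists i, vheight i = hi) /\ forall i, vheight i <= hi.
Proof.
pose i0 := [arg max_(i > ord0 | true) vheight i]%O.
have le_hz i : vheight i <= vheight i0.
  by rewrite /i0; case: arg_maxP => // j _; apply.
have le_height x : P x -> height w x <= (vheight i0)%:~R.
  rewrite PE => Px.
  move: x Px; apply: (@conv_min _ _ [set x | height w x <= (vheight i0)%:~R]).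
    exact/convex_le/height_affine.
  by move=> _ [i _ <-] /=; rewrite height_vertex ler_int.
suff -> : hi = vheight i0 by split=> //; exists i0.
apply: xget_subset1 => /=.
  split=> //; exists (v i0); split; [exact: vertex_in|exact: height_vertex].
move=> h h' [[x [Px xh]] hle] [[x' [Px' xh']] h'le].
apply/eqP; rewrite eq_le -(ler_int rat) -[_ <= h](ler_int rat).
by rewrite -{1}xh -{2}xh' hle // h'le.
Qed.

Lemma height_bary x : height w x = \sum_i b i x * (vheight i)%:~R.
Proof.
rewrite -{1}(bary_sum v_ind x) affine_sum ?bary_sum1 //.
  by apply: eq_bigr => i _; rewrite height_vertex.
exact: height_affine.
Qed.

Lemma height_min x : P x -> lo%:~R <= height w x.
Proof.
move=> /inP b_ge0; rewrite height_bary.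
have -> : lo%:~R = \sum_i b i x * lo%:~R by rewrite -mulr_suml bary_sum1 ?mul1r.
apply: ler_sum => i _; apply: ler_wpM2l => //.
by rewrite ler_int; case: h_min_vertex.
Qed.

Lemma height_max x : P x -> height w x <= hi%:~R.
Proof.
move=> /inP b_ge0; rewrite height_bary.
have -> : hi%:~R = \sum_i b i x * hi%:~R by rewrite -mulr_suml bary_sum1 ?mul1r.
apply: ler_sum => i _; apply: ler_wpM2l => //.
by rewrite ler_int; case: h_max_vertex.
Qed.

Lemma h_min_lt0 : lo < 0.
Proof.
have [x Px] := w_neg; have := height_min Px => le lt.
by rewrite -(ltr_int rat); apply: le_lt_trans lt.
Qed.

Lemma h_max_gt0 : 0 < hi.
Proof.
have [x Px] := w_pos; have := height_max Px => le lt.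
by rewrite -(ltr_int rat); apply: lt_le_trans le.
Qed.

Lemma slice_sub h : slice w P h `<=` hyperplane w h `&` P.
Proof.
apply: conv_min => [x y t [xh Px] [yh Py] t01|x [] //]; split.
  exact: (convex_eq (height_affine w)).
exact: convexP.
Qed.

Lemma vertex_slice i : slice w P (vheight i) (v i).
Proof.
apply: sub_conv; split; last by rewrite v_int; exists (z i).
by split; [exact: height_vertex|exact: vertex_in].
Qed.

Lemma vertex_hyperplane h x :
  (hyperplane w h `&` vert P) x <-> exists2 i, vheight i = h & x = v i.
Proof.
rewrite vertP; split=> [[xh [i _ ix]]|[i ih ->]].
  exists i => //; move: xh; rewrite -ix /hyperplane /= height_vertex.
  by move/eqP; rewrite eqr_int => /eqP.
by split; [rewrite /hyperplane /= height_vertex ih|exists i].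
Qed.

(** Averaging [vheight j - lo] with weights [b j x] gives [height w x - lo], which is 0; as no term
    is negative, each vanishes. *)
Lemma slice_min_bary x i :
  slice w P lo x -> vheight i != lo -> b i x = 0.
Proof.
move=> /slice_sub[xh /inP b_ge0] ilo.
have : \sum_j b j x * ((vheight j)%:~R - lo%:~R) = 0.
  under eq_bigr do rewrite mulrBr.
  rewrite sumrB -height_bary -mulr_suml bary_sum1 // mul1r xh subrr //.
have ge0 j : true -> 0 <= b j x * ((vheight j)%:~R - lo%:~R).
  by rewrite mulr_ge0 // subr_ge0 ler_int h_min_vertex.2.
move/(psumr_eq0P ge0)/(_ i isT)/eqP.
by rewrite mulf_eq0 subr_eq0 eqr_int (negPf ilo) orbF => /eqP.
Qed.

Lemma slice_max_bary x i :
  slice w P hi x -> vheight i != hi -> b i x = 0.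
Proof.
move=> /slice_sub[xh /inP b_ge0] ihi.
have : \sum_j b j x * (hi%:~R - (vheight j)%:~R) = 0.
  under eq_bigr do rewrite mulrBr.
  rewrite sumrB -height_bary -mulr_suml bary_sum1 // mul1r xh subrr //.
have ge0 j : true -> 0 <= b j x * (hi%:~R - (vheight j)%:~R).
  by rewrite mulr_ge0 // subr_ge0 ler_int h_max_vertex.2.
move/(psumr_eq0P ge0)/(_ i isT)/eqP.
rewrite mulf_eq0 subr_eq0 eqr_int [_ == vheight i]eq_sym (negPf ihi) orbF.
by move/eqP.
Qed.

(** The sets chosen inside [mut] are arbitrary, and later arguments use only these properties of
    them. *)
Lemma mut_complement F h : is_factor w P F -> lo <= h < 0 ->
  complement w P F h (xget set0 (complement w P F h)).
Proof. by move=> [_ _ ex] lh; apply: xgetPex; exact: ex. Qed.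

(** Adding a dilate of [[set 0]] changes nothing, so each [G_h] lies between the vertices at height
    [h] and the slice, and the mutation is [P] itself. *)
Lemma mut_point : is_factor w P [set 0] /\ simplex (mut w P [set 0]).
Proof.
have add0 A h : add_dilate A h [set (0 : 'rV[rat]_n)] = A.
  apply/seteqP; split=> [_ [a Aa [_ -> <-]]|a Aa].
    by rewrite scaler0 addr0.
  by exists a => //; exists 0; rewrite // scaler0 addr0.
have F_factor : is_factor w P [set 0].
  split.
  - exists [:: 0]; rewrite -[LHS]conv1; congr conv.
    apply/seteqP; split=> [_ ->|_ [y /= + <-]].
      by exists 0; [rewrite /= inE|rewrite embed0].
    by rewrite inE => /eqP ->; rewrite embed0.
  - by move=> _ ->; rewrite -(scale0r 0) heightZ mul0r.
  move=> h _; exists (conv (v @` [set` [pred i | vheight i == h]])); split.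
  - have -> : v = fun i => embed (z i) by apply: funext.
    exact: lattice_polytope_image.
  - move=> x /vertex_hyperplane[i ih ->]; rewrite add0.
    by apply: sub_conv; exists i => //=; rewrite inE ih.
  - rewrite add0; apply: conv_min; first exact: conv_convex.
    by move=> _ [i /= /eqP <- <-]; exact: vertex_slice.
split=> //; exists n, v; split=> //; rewrite -PE.
apply/seteqP; split.
  apply: conv_min; first exact: convexP.
  move=> x [[h lh /=]|[h lh]]; last by rewrite add0 => /slice_sub[].
  have [_ _] := mut_complement F_factor lh; rewrite add0 => sub Gx.
  by have [] := slice_sub (sub _ Gx).
rewrite {1}PE; apply: conv_min; first exact: conv_convex.
move=> _ [i _ <-]; apply: sub_conv.
have [neg|pos] := ltP (vheight i) 0.
  have lh : lo <= vheight i < 0 by rewrite neg h_min_vertex.2.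
  have [_ + _] := mut_complement F_factor lh; rewrite add0 => sub.
  left; exists (vheight i) => //; apply: sub.
  by apply/vertex_hyperplane; exists i.
right; exists (vheight i); first by rewrite /= pos h_max_vertex.2.
by rewrite add0; exact: vertex_slice.
Qed.


(** * A mutation that is a simplex *)

Section Mutable.
Variables i0 i1 i2 : 'I_n.+1.
Hypotheses (hz_i0 : vheight i0 = hi).
Hypotheses (hz_top : forall i, vheight i = hi -> i = i0).
Hypotheses (hz_i1 : vheight i1 = lo) (hz_i2 : vheight i2 = lo) (i21 : i2 != i1).
Hypothesis hz_cases : forall i,
  [\/ vheight i = hi, vheight i = lo | vheight i = 0].
Variable y : 'I_n.+1 -> 'rV[int]_n.
Hypothesis y_dvd : forall i, vheight i = lo -> v i - v i1 = embed (y i *~ lo).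

Let K := [pred i | vheight i == lo].
Let m : rat := (- lo)%:~R.
Let M : rat := hi%:~R.
(** The sign compensates [m = - lo]: for [i] in [K], [f i] is [v i - v i1] divided by [m]. *)
Let f i := embed (- y i).
Let F := conv (f @` [set` K]).

Let m_gt0 : 0 < m.
Proof. by rewrite ltr0z oppr_gt0; exact: h_min_lt0. Qed.

Let M_gt0 : 0 < M.
Proof. by rewrite ltr0z; exact: h_max_gt0. Qed.

Let i0K : i0 \notin K.
Proof.
by rewrite inE hz_i0 gt_eqF // (lt_trans h_min_lt0 h_max_gt0).
Qed.

Let i1K : i1 \in K. Proof. by rewrite inE hz_i1. Qed.
Let i2K : i2 \in K. Proof. by rewrite inE hz_i2. Qed.

Let mf i : i \in K -> m *: f i = v i - v i1.
Proof.
move=> /eqP /y_dvd ->; rewrite embedMz /f embedN scalerN /m rmorphN.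
by rewrite scaleNr opprK.
Qed.

Let f_i1 : f i1 = 0.
Proof.
have /eqP := mf i1K; rewrite subrr scaler_eq0 gt_eqF //= => /eqP.
exact.
Qed.

Let scale_f (c : rat) i : i \in K -> c *: f i = (c / m) *: (v i - v i1).
Proof. by move=> Ki; rewrite -mf // scalerA divfK // gt_eqF. Qed.

Let f_height i : i \in K -> height w (f i) = 0.
Proof.
move=> Ki; rewrite -[f i]scale1r scale_f // heightZ heightB !height_vertex.
by rewrite hz_i1 (eqP Ki) subrr mulr0.
Qed.

Let fF i : i \in K -> F (f i).
Proof. by move=> Ki; apply: sub_conv; exists i. Qed.

Let F_height x : F x -> height w x = 0.
Proof.
move: x; apply: conv_min; first exact/convex_eq/height_affine.
by move=> _ [i Ki <-]; exact: f_height.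
Qed.

Let F_factor : is_factor w P F.
Proof.
split=> //; first exact: lattice_polytope_image.
(* No vertex has height strictly between [lo] and 0, so the empty set serves as [G_h] there. *)
move=> h /andP[lo_h h0]; have [->|h_lo] := eqVneq h lo; last first.
  exists set0; split.
  - exists [::]; rewrite -[LHS]conv0; congr conv; symmetry.
    by rewrite -subset0 => x [x1].
  - move=> x /vertex_hyperplane[i ih]; have := hz_cases i; rewrite ih.
    case=> e; first by move: h0; rewrite e ltNge ltW // h_max_gt0.
      by rewrite e eqxx in h_lo.
    by move: h0; rewrite e ltxx.
  - by move=> x [].
exists [set v i1]; split.
- exists [:: z i1]; rewrite -[LHS]conv1; congr conv; rewrite v_int.
  apply/seteqP; split=> [_ ->|_ [x /= + <-]].
    by exists (z i1); rewrite //= inE.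
  by rewrite inE => /eqP ->.
- move=> _ /vertex_hyperplane[i ih ->]; have Ki : i \in K by rewrite inE ih.
  exists (v i1) => //; exists (f i); first exact: fF.
  by rewrite mf // addrC subrK.
- move=> _ [_ -> [x Fx <-]].
  move: x Fx.
  apply: (@conv_min _ _ [set x | slice w P lo (v i1 + (- lo)%:~R *: x)]).
    by apply: convex_preimage; exact: conv_convex.
  move=> _ [i Ki <-] /=; rewrite mf // addrC subrK -(eqP Ki).
  exact: vertex_slice.
Qed.

Let F_nontrivial : nontrivial F.
Proof.
exists (f i1), (f i2); split; [exact: fF|exact: fF|move=> f12].
have := mf i2K; rewrite -f12 mf // subrr => /esym /eqP.
by rewrite subr_eq0 => /eqP /(aff_indep_inj v_ind) /eqP; exact/negP.
Qed.

(* The vertices of the mutation. *)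
Let p i := if i == i0 then v i1 else if i \in K then v i0 + M *: f i else v i.

Let p_i0 : p i0 = v i1. Proof. by rewrite /p eqxx. Qed.

Let p_K i : i \in K -> p i = v i0 + M *: f i.
Proof. by rewrite /p; case: eqP => [->|_ ->//]; rewrite (negPf i0K). Qed.

(** Inverts the definition of [p]: since [f i1] is 0, [p i1] is the old top vertex, and [p i - p i1]
    is [M / m] times [v i - v i1]. Independence of [p] and its barycentric coordinates are read off
    from this. *)
Let v_p i : v i = if i == i0 then p i1 else
  if i \in K then p i0 + (m / M) *: (p i - p i1) else p i.
Proof.
have [->|ii0] := eqVneq i i0; first by rewrite p_K // f_i1 scaler0 addr0.
case: ifPn => Ki; last by rewrite /p (negPf ii0) (negPf Ki).
rewrite p_i0 !p_K // f_i1 scaler0 addr0 [v i0 + _]addrC addrK scalerA.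
by rewrite divfK ?gt_eqF // mf // addrC subrK.
Qed.

Let p_ind : aff_indep p.
Proof.
apply: (aff_indep_span v_ind) => i; rewrite v_p.
case: ifP => _; first exact: aff_span_refl.
case: ifP => _; last exact: aff_span_refl.
apply: aff_span_add; exact: aff_span_refl.
Qed.

Let bary_p_v j i : bary p j (v i) = if i == i0 then (j == i1)%:R else
  if i \in K then (j == i0)%:R + (m / M) * ((j == i)%:R - (j == i1)%:R)
  else (j == i)%:R.
Proof.
rewrite v_p; case: ifP => _; first exact: bary_vertex.
case: ifP => _; last exact: bary_vertex.
by rewrite bary_affine !bary_vertex.
Qed.

(** From here to [bary_p_0], coordinates with respect to [p] are expressed by the height and the
    coordinates with respect to [v]. Everything is affine in [x], so the values at the [v i]
    decide. *)
Let bary_p_i0 x : bary p i0 x = \sum_(i in K) b i x.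
Proof.
rewrite -{1}(bary_sum v_ind x) affine_sum ?bary_sum1 //;
  last exact: bary_affine.
rewrite [RHS]big_mkcond; apply: eq_bigr => i _; rewrite bary_p_v eqxx.
have i01 : (i0 == i1) = false by apply: contraNF i0K => /eqP ->.
have [->|ii0] := eqVneq i i0; first by rewrite i01 (negPf i0K) mulr0.
case: ifPn => Ki; last by rewrite mulr0.
by rewrite i01 subrr mulr0 addr0 mulr1.
Qed.

Let bary_p_K j x : j \in K -> j != i1 -> M * bary p j x = m * b j x.
Proof.
move=> Kj ji1; move: x; apply: (affine_ext v_ind).
- by move=> c x x' x''; rewrite bary_affine; ring.
- by move=> c x x' x''; rewrite bary_affine; ring.
have ji0 : (j == i0) = false by apply: contraNF i0K => /eqP <-.
move=> i; rewrite bary_p_v bary_vertex // (negPf ji1).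
have [->|ii0] := eqVneq i i0; first by rewrite ji0 !mulr0.
case: ifPn => Ki.
  by rewrite ji0 add0r subr0 mulrA [M * _]mulrC divfK ?(gt_eqF M_gt0).
have -> : (j == i) = false by apply: contraNF Ki => /eqP e; rewrite -e.
by rewrite !mulr0.
Qed.

(** At a vertex that is neither top nor bottom the right side is its height, which must be 0:
    condition (iii) enters here. *)
Let bary_p_i1 x : M * bary p i1 x = height w x + m * b i1 x.
Proof.
move: x; apply: (affine_ext v_ind).
- by move=> c x x' x''; rewrite bary_affine; ring.
- by move=> c x x' x''; rewrite bary_affine height_affine; ring.
have i10 : (i1 == i0) = false by apply: contraNF i0K => /eqP <-.
move=> i; rewrite bary_p_v bary_vertex // height_vertex eqxx i10.
have [->|ii0] := eqVneq i i0; first by rewrite i10 hz_i0 mulr1 mulr0 addr0.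
case: ifPn => Ki.
  rewrite add0r mulrA [M * _]mulrC divfK ?(gt_eqF M_gt0) // (eqP Ki) /m.
  rewrite rmorphN /=; ring.
have -> : (i1 == i) = false by apply: contraNF Ki => /eqP <-.
have [/hz_top /eqP|/eqP|->] := hz_cases i; last by rewrite !mulr0 addr0.
- by rewrite (negPf ii0).
- by move: Ki; rewrite inE => /negPf ->.
Qed.

Let bary_p_0 j x : j \notin K -> j != i0 -> bary p j x = b j x.
Proof.
move=> Kj ji0; move: x; apply: (affine_ext v_ind); try exact: bary_affine.
move=> i; rewrite bary_p_v bary_vertex //.
have ji1 : (j == i1) = false by apply: contraNF Kj => /eqP ->.
have [->|ii0] := eqVneq i i0; first by rewrite ji1 (negPf ji0).
case: ifPn => Ki //; have -> : (j == i) = false.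
  by apply: contraNF Kj => /eqP ->.
by rewrite (negPf ji0) ji1 subrr mulr0 addr0.
Qed.

(** Compared with the inequalities that define [P], those for the coordinates [i0] and [i1] are
    replaced by the first two. *)
Let in_conv_p x : 0 <= \sum_(i in K) b i x -> 0 <= height w x + m * b i1 x ->
  (forall i, i != i0 -> i != i1 -> 0 <= b i x) -> conv (range p) x.
Proof.
move=> x_i0 x_i1 x_i; apply/(conv_bary p_ind) => j.
have [->|ji0] := eqVneq j i0; first by rewrite bary_p_i0.
have [->|ji1] := eqVneq j i1; first by rewrite -(pmulr_rge0 _ M_gt0) bary_p_i1.
have [Kj|Kj] := boolP (j \in K); last by rewrite bary_p_0 // x_i.
by rewrite -(pmulr_rge0 _ M_gt0) bary_p_K // mulr_ge0 ?x_i // ltW.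
Qed.

Let complement_height G h x : complement w P F h G -> G x ->
  forall i, i \in K -> slice w P h (x + (- h)%:~R *: f i).
Proof.
move=> [_ _ sub] Gx i Ki; apply: sub; exists x => //.
by exists (f i); [exact: fF|].
Qed.

Let mut_sub : mut w P F `<=` conv (range p).
Proof.
apply: conv_min; first exact: conv_convex.
move=> x [[h lh /=]|[h /= /andP[h_ge0 _]]].
  have /andP[lo_h h_lt0] := lh.
  move=> /(complement_height (mut_complement F_factor lh)) x_f.
  have [xh /inP b_ge0] : (hyperplane w h `&` P) x.
    by have /slice_sub := x_f _ i1K; rewrite f_i1 scaler0 addr0.
  (* Adding [- h] times [f i2] lowers the coordinate at [i1] by [- h / m]. Since the result is still
     in [P], [b i1 x] is at least [- h / m], which is the second inequality of [in_conv_p]. *)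
  have [_ /inP /(_ i1)] := slice_sub (x_f _ i2K).
  rewrite scale_f // bary_affine !bary_vertex // eqxx eq_sym (negPf i21).
  move=> b_i1.
  apply: in_conv_p => [||i _ _] //; first exact: sumr_ge0.
  have -> : height w x + m * b i1 x =
      m * (b i1 x + (- h)%:~R / m * (0%:R - 1%:R)).
    rewrite xh; have : m / m = 1 by rewrite divff // gt_eqF.
    rewrite rmorphN mulrDr !mulrA => mm.
    by rewrite [m * - _]mulrC -[_ * m / m]mulrA mm; ring.
  by rewrite mulr_ge0 // ltW.
move=> [{}x /slice_sub[xh /inP b_ge0] [x' Fx' <-]].
move: x' Fx'.
apply: (@conv_min _ _ [set x' | conv (range p) (x + h%:~R *: x')]).
  by apply: convex_preimage; exact: conv_convex.
move=> _ [i Ki <-] /=.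
(* Adding [h] times [f i] moves weight [h / m] from [i1] to [i]. The total over [K] is unchanged,
   and the height [h] makes up for the loss at [i1]. *)
have hm_ge0 : 0 <= h%:~R / m :> rat by rewrite divr_ge0 ?(ltW m_gt0) ?ler0z.
have b_add j : b j (x + h%:~R *: f i) =
    b j x + h%:~R / m * ((j == i)%:R - (j == i1)%:R).
  by rewrite scale_f // bary_affine !bary_vertex.
apply: in_conv_p.
- under eq_bigr do rewrite b_add.
  have sum1 l : l \in K -> \sum_(j in K) (j == l)%:R = 1 :> rat.
    move=> Kl; rewrite (bigD1 l) //= eqxx big1 ?addr0 // => j /andP[_].
    by move=> /negPf ->.
  rewrite big_split /= -mulr_sumr sumrB !sum1 // subrr mulr0 addr0.
  exact: sumr_ge0.
- rewrite heightD heightZ f_height // mulr0 addr0 xh b_add eqxx.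
  have -> : h%:~R + m * (b i1 x + h%:~R / m * ((i1 == i)%:R - 1%:R)) =
      m * b i1 x + h%:~R * (i1 == i)%:R.
    have mm : m / m = 1 by rewrite divff // gt_eqF.
    transitivity (h%:~R + m * b i1 x + (m / m) * (h%:~R * ((i1 == i)%:R - 1))).
      by ring.
    by rewrite mm; ring.
  by rewrite addr_ge0 // mulr_ge0 ?(ltW m_gt0) ?ler0n ?ler0z.
- move=> j _ ji1; rewrite b_add (negPf ji1) subr0 addr_ge0 //.
  by rewrite mulr_ge0 // ler0n.
Qed.

Let sub_mut : conv (range p) `<=` mut w P F.
Proof.
apply: conv_min; first exact: conv_convex.
move=> _ [i _ <-]; apply: sub_conv.
have [->|ii0] := eqVneq i i0.
  rewrite p_i0; left; exists lo; first by rewrite /= lexx h_min_lt0.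
  have lh : lo <= lo < 0 by rewrite lexx h_min_lt0.
  have comp := mut_complement F_factor lh.
  have v_i1 : (hyperplane w lo `&` vert P) (v i1).
    by apply/vertex_hyperplane; exists i1.
  have [_ /(_ _ v_i1)[x Gx _] _] := comp.
  have x_f := complement_height comp Gx.
  (* The chosen set at height [lo] need not be [[set v i1]] by construction, but any [x] in it has
     [x + m *: f i2] in [P], which forces [b i1 x] to be at least 1. *)
  suff <- : x = v i1 by [].
  apply: bary_ge1.
    by have /slice_sub[] := x_f _ i1K; rewrite f_i1 scaler0 addr0.
  have [_ /inP /(_ i1)] := slice_sub (x_f _ i2K).
  rewrite scale_f // bary_affine !bary_vertex // eqxx eq_sym (negPf i21).
  by rewrite divff ?gt_eqF //=; lra.
right; have [Ki|Ki] := boolP (i \in K).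
  exists hi; first by rewrite /= (ltW h_max_gt0) ?lexx.
  rewrite p_K //; exists (v i0); first by rewrite -hz_i0; exact: vertex_slice.
  by exists (f i) => //; exact: fF.
have hz_i : vheight i = 0.
  have [/hz_top /eqP|/eqP|//] := hz_cases i; first by rewrite (negPf ii0).
  by move: Ki; rewrite inE => /negPf ->.
exists 0; first by rewrite /= (ltW h_max_gt0) ?lexx.
exists (v i); first by rewrite -hz_i; exact: vertex_slice.
exists (f i1); first exact: fF.
by rewrite f_i1 scaler0 addr0 /p (negPf ii0) (negPf Ki).
Qed.

Lemma mutation_simplex :
  exists F, [/\ is_factor w P F, nontrivial F & simplex (mut w P F)].
Proof.
exists F; split=> //; exists n, p; split=> //.
by apply/seteqP; split.
Qed.

End Mutable.

(** * Constraints imposed by a simplicial mutation *)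

Section SimplexMutation.
Variable F : set 'rV[rat]_n.
Hypotheses (F_factor : is_factor w P F) (F_nontrivial : nontrivial F).
Hypothesis mut_simplex : simplex (mut w P F).

Let K := [pred i | vheight i == lo].
Let m : rat := (- lo)%:~R.
Let G h := xget set0 (complement w P F h).

Let m_gt0 : 0 < m.
Proof. by rewrite ltr0z oppr_gt0; exact: h_min_lt0. Qed.

Let lo_lo : lo <= lo < 0.
Proof. by rewrite lexx h_min_lt0. Qed.

Let F_height x : F x -> height w x = 0.
Proof. by have [_ + _] := F_factor; apply. Qed.

Let slice_add h x y :
  lo <= h < 0 -> G h x -> F y -> slice w P h (x + (- h)%:~R *: y).
Proof.
move=> lh Gx Fy; have [_ _ sub] := mut_complement F_factor lh.
by apply: sub; exists x => //; exists y.
Qed.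

Let G_height h x : lo <= h < 0 -> G h x -> height w x = h%:~R.
Proof.
move=> lh Gx; have [y [_ [Fy _ _]]] := F_nontrivial.
have [xyh _] := slice_sub (slice_add lh Gx Fy); rewrite -xyh.
by rewrite heightD heightZ (F_height Fy) mulr0 addr0.
Qed.

Let split_vertex i h : lo <= h < 0 -> vheight i = h ->
  exists g f, [/\ G h g, F f & v i = g + (- h)%:~R *: f].
Proof.
move=> lh ih; have [_ sub _] := mut_complement F_factor lh.
have [|g Gg [f Ff <-]] := sub (v i); last by exists g, f.
by apply/vertex_hyperplane; exists i.
Qed.

(** Made total by the pair [(0, 0)] outside [K], so that [choice] gives functions [g] and [f] of all
    indices. *)
Let splitting i : exists gf : 'rV[rat]_n * 'rV[rat]_n, i \in K ->
  [/\ G lo gf.1, F gf.2 & v i = gf.1 + m *: gf.2].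
Proof.
have [Ki|_] := boolP (i \in K); last by exists (0, 0).
by have [g [f ?]] := split_vertex lo_lo (eqP Ki); exists (g, f).
Qed.

Let g i := (projT1 (choice splitting) i).1.
Let f i := (projT1 (choice splitting) i).2.

Let gfP i : i \in K -> [/\ G lo (g i), F (f i) & v i = g i + m *: f i].
Proof. exact: projT2 (choice splitting) i. Qed.

Let gG i : i \in K -> G lo (g i). Proof. by case/gfP. Qed.
Let fF i : i \in K -> F (f i). Proof. by case/gfP. Qed.
Let gf_sum i : i \in K -> v i = g i + m *: f i. Proof. by case/gfP. Qed.

Let vert_v i : vert P (v i).
Proof. by rewrite vertP; exists i. Qed.

(** Splitting [f i] inside [F] would split the vertex [v i] inside [P], because [g i + m F] lies in
    [P]. The argument for [vert_g] is symmetric. *)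
Let vert_f i : i \in K -> vert F (f i).
Proof.
move=> Ki; split; first exact: fF.
move=> x y t Fx Fy t01 fE.
have vE : v i = t *: (g i + m *: x) + (1 - t) *: (g i + m *: y).
  by rewrite gf_sum // fE; apply/rowP => l; rewrite !mxE; ring.
have /addrI := (vert_v i).2 _ _ t (slice_sub (slice_add lo_lo (gG Ki) Fx)).2
  (slice_sub (slice_add lo_lo (gG Ki) Fy)).2 t01 vE.
by apply: scalerI; rewrite gt_eqF.
Qed.

Let vert_g i : i \in K -> vert (G lo) (g i).
Proof.
move=> Ki; split; first exact: gG.
move=> x y t Gx Gy t01 gE.
have vE : v i = t *: (x + m *: f i) + (1 - t) *: (y + m *: f i).
  by rewrite gf_sum // {1}gE; apply/rowP => l; rewrite !mxE; ring.
have /addIr := (vert_v i).2 _ _ t (slice_sub (slice_add lo_lo Gx (fF Ki))).2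
  (slice_sub (slice_add lo_lo Gy (fF Ki))).2 t01 vE.
exact.
Qed.

(** Among the generators of the mutation, those of least height are the points of [G lo]. *)
Let vert_mut_g i : i \in K -> vert (mut w P F) (g i).
Proof.
move=> Ki; rewrite /mut.
apply: (@vert_face _ _ (fun x => - height w x) m (G lo)).
- by move=> c x y y'; rewrite height_affine; ring.
- by apply: lattice_polytope_convex; case: (mut_complement F_factor lo_lo).
- move=> s [[h lh /(G_height lh) ->]|[h /andP[h0 _] [x xh [y Fy <-]]]].
    by rewrite /m rmorphN lerN2 ler_int; case/andP: lh.
  have [xh' _] := slice_sub xh.
  rewrite heightD heightZ (F_height Fy) mulr0 addr0 xh' /m -rmorphN ler_int.
  by rewrite lerN2 (le_trans _ h0) // ltW // h_min_lt0.
- move=> s [[h lh Gx]|[h /andP[h0 _] [x xh [y Fy <-]]]].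
    rewrite (G_height lh Gx) /m rmorphN => /oppr_inj/eqP; rewrite eqr_int.
    by move=> /eqP <-.
  have [xh' _] := slice_sub xh.
  rewrite heightD heightZ (F_height Fy) mulr0 addr0 xh' /m rmorphN.
  move=> /oppr_inj/eqP; rewrite eqr_int => /eqP hlo; move: h0.
  by rewrite hlo leNgt h_min_lt0.
- by left; exists lo => //; exact: gG.
- by rewrite (G_height lo_lo (gG Ki)) /m rmorphN.
- exact: vert_g.
Qed.

Let bary_slice x i : i \notin K -> slice w P lo x -> b i x = 0.
Proof. by move=> Ki xlo; apply: slice_min_bary xlo _. Qed.

Let bary_le1 x i : P x -> b i x <= 1.
Proof.
move=> /inP b_ge0; rewrite -(bary_sum1 v_ind x) (bigD1 i) //= lerDl.
exact: sumr_ge0.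
Qed.

(* On the face where [b j (x - height w x *: f i)] is 1 the mutation is
   [v j + vheight j F]. *)
Let vert_mut_f i j : i \in K -> 0 < vheight j ->
  vert (mut w P F) (v j + (vheight j)%:~R *: f i).
Proof.
move=> Ki hj0.
pose l x := b j (x - height w x *: f i).
have jK : j \notin K by rewrite inE gt_eqF // (lt_trans h_min_lt0).
have l_aff : affine l.
  move=> c x y y'; rewrite /l -bary_affine height_affine; congr bary.
  by apply/rowP => k; rewrite !mxE; ring.
(* [b j] vanishes on the bottom slice, which contains [g i + m *: y] and [g i + m *: f i]; hence
   [b j] is constant in the direction [y - f i]. *)
have l_F (h : int) x y : F y -> height w x = h%:~R ->
    l (x + h%:~R *: y) = b j x.
  move=> Fy xh; rewrite /l heightD heightZ (F_height Fy) mulr0 addr0 xh.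
  rewrite -addrA -scalerBr.
  have -> : h%:~R *: (y - f i) =
      (h%:~R / m) *: ((g i + m *: y) - (g i + m *: f i)).
    by rewrite opprD addrACA subrr add0r -scalerBr scalerA divfK // gt_eqF.
  rewrite bary_affine (bary_slice jK (slice_add lo_lo (gG Ki) Fy)).
  rewrite (bary_slice jK (slice_add lo_lo (gG Ki) (fF Ki))).
  by rewrite subrr mulr0 addr0.
have l_G h x : lo <= h < 0 -> G h x -> l x = b j (x + (- h)%:~R *: f i).
  by move=> lh Gx; rewrite /l (G_height lh Gx) rmorphN scaleNr.
rewrite /mut; apply: (@vert_face _ _ l 1
    [set x | exists2 y, F y & x = v j + (vheight j)%:~R *: y]) => //.
- move=> _ _ t [x Fx ->] [y Fy ->] t01.
  exists (t *: x + (1 - t) *: y).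
    by case: F_factor => /lattice_polytope_convex F_cvx _ _; exact: F_cvx.
  rewrite !scalerDr addrACA -scalerDl [t + _]addrC subrK scale1r.
  by rewrite !scalerA ![_%:~R * _]mulrC.
- move=> s [[h lh Gx]|[h _ [x xh [y Fy <-]]]].
    rewrite (l_G _ _ lh Gx); apply: bary_le1.
    exact: (slice_sub (slice_add lh Gx (fF Ki))).2.
  have [xh' Px] := slice_sub xh.
  by rewrite l_F //; exact: bary_le1.
- move=> s [[h lh Gx]|[h _ [x xh [y Fy <-]]]].
    rewrite (l_G _ _ lh Gx).
    have [xh Px] := slice_sub (slice_add lh Gx (fF Ki)).
    move=> b1; have xE : s + (- h)%:~R *: f i = v j.
      by apply: bary_ge1; rewrite ?b1.
    move: xh; rewrite xE /hyperplane /= height_vertex.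
    move=> /eqP; rewrite eqr_int => /eqP jh; move: hj0.
    by case/andP: lh => _ h0; rewrite jh ltNge ltW.
  have [xh' Px] := slice_sub xh; rewrite l_F // => b1.
  have xE : x = v j by apply: bary_ge1; rewrite ?b1.
  exists y => //; move: xh'; rewrite xE /hyperplane /= height_vertex.
  by move=> /eqP; rewrite eqr_int => /eqP ->.
- right; exists (vheight j); first by rewrite /= ltW //= h_max_vertex.2.
  by exists (v j); [exact: vertex_slice|exists (f i) => //; exact: fF].
- by rewrite l_F ?height_vertex ?bary_vertex ?eqxx //; exact: fF.
split; first by exists (f i) => //; exact: fF.
have hj_neq0 : (vheight j)%:~R != 0 :> rat by rewrite intr_eq0 gt_eqF.
move=> _ _ t [x Fx ->] [y Fy ->] t01 fE; congr (_ + _ *: _).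
have [_ f_ext] := vert_f Ki; apply: (f_ext x y t) => //.
apply: (scalerI hj_neq0); apply: (addrI (v j)); rewrite fE.
rewrite !scalerDr addrACA -scalerDl [t + _]addrC subrK scale1r.
by rewrite !scalerA ![_%:~R * _]mulrC.
Qed.

(** The points [g i + m *: f j] and [g j + m *: f i] lie in [P] and have sum [v i + v j]. Their
    coordinates other than [i] and [j] are nonnegative with sum 0, so the first point is on the
    edge, and [mu] is its coordinate at [j]. *)
Let edge i j : i \in K -> j \in K -> i != j ->
  exists mu, [/\ 0 <= mu <= 1, m *: (f j - f i) = mu *: (v j - v i)
    & g j - g i = (1 - mu) *: (v j - v i)].
Proof.
move=> Ki Kj ij.
pose x := g i + m *: f j; pose y := g j + m *: f i.
have xlo : slice w P lo x by apply: slice_add => //; [exact: gG|exact: fF].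
have ylo : slice w P lo y by apply: slice_add => //; [exact: gG|exact: fF].
have xy : y = v i + 1 *: (v j - x).
  by rewrite (gf_sum Ki) (gf_sum Kj); apply/rowP => l; rewrite !mxE; ring.
have Px : forall l, 0 <= b l x := (inP x).1 (slice_sub xlo).2.
have Py : forall l, 0 <= b l y := (inP y).1 (slice_sub ylo).2.
have bxy l : b l x + b l y = (l == i)%:R + (l == j)%:R.
  by rewrite xy bary_affine !bary_vertex //; ring.
have bx0 l : l != i -> l != j -> b l x = 0.
  move=> li lj; have := bxy l; rewrite (negPf li) (negPf lj) /= => e.
  by apply/eqP; rewrite eq_le Px andbT; have := Py l; lra.
have xE : x = v i + b j x *: (v j - v i).
  have biE : b i x = 1 - b j x.
    rewrite -(bary_sum1 v_ind x) (bigD1 i) //= (bigD1 j) 1?eq_sym //=.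
    rewrite big1 ?addr0 ?addrK // => l /andP[li lj]; exact: bx0.
  rewrite -{1}(bary_sum v_ind x) (bigD1 i) //= (bigD1 j) 1?eq_sym //=.
  rewrite big1 ?addr0 => [|l /andP[li lj]]; last by rewrite bx0 // scale0r.
  by rewrite biE; apply/rowP => l; rewrite !mxE; ring.
have fji : m *: (f j - f i) = b j x *: (v j - v i).
  apply: (addrI (v i)); rewrite -xE (gf_sum Ki).
  by apply/rowP => l; rewrite !mxE; ring.
exists (b j x); split=> //.
  by rewrite Px bary_le1 //; exact: (slice_sub xlo).2.
rewrite scalerBl scale1r -fji (gf_sum Ki) (gf_sum Kj).
by apply/rowP => l; rewrite !mxE; ring.
Qed.

Let f_eq_or_g_eq i j : i \in K -> j \in K -> f i = f j \/ g i = g j.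
Proof.
move=> Ki Kj; have [->|ij] := eqVneq i j; first by left.
have [mu [/andP[mu0 mu1] fE gE]] := edge Ki Kj ij.
have [->|fij] := eqVneq (f i) (f j); first by left.
have [->|gij] := eqVneq (g i) (g j); first by right.
have mu_gt0 : 0 < mu.
  rewrite lt_neqAle mu0 andbT; apply: contraNneq fij => mu_0.
  move/eqP: fE; rewrite -mu_0 scale0r scaler_eq0 (gt_eqF m_gt0) /= subr_eq0.
  by rewrite eq_sym.
have mu_lt1 : mu < 1.
  rewrite lt_neqAle mu1 andbT; apply: contraNneq gij => mu_1.
  by move/eqP: gE; rewrite mu_1 subrr scale0r subr_eq0 eq_sym.
have [[top top_hi] _] := h_max_vertex.
have top_gt0 : 0 < vheight top by rewrite top_hi h_max_gt0.
have hi_gt0 : 0 < (vheight top)%:~R :> rat by rewrite ltr0z.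
(* If both differences were nonzero, [mu] would be strictly between 0 and 1 and these two edges of
   the mutation would be parallel. [vert_simplex] then identifies endpoints of heights [lo] and
   [hi]. *)
have cE : g j - g i = ((1 - mu) / mu * m / (vheight top)%:~R) *:
    (v top + (vheight top)%:~R *: f j - (v top + (vheight top)%:~R *: f i)).
  rewrite opprD addrACA subrr add0r -scalerBr scalerA divfK ?gt_eqF //.
  by rewrite -scalerA fE scalerA divfK ?gt_eqF.
have := @vert_simplex _ _ _ _ _ _ _ mut_simplex (vert_mut_g Kj)
  (vert_mut_g Ki) (vert_mut_f Kj top_gt0) (vert_mut_f Ki top_gt0) _ _ cE.
have -> : 0 < (1 - mu) / mu * m / (vheight top)%:~R.
  by rewrite divr_gt0 // mulr_gt0 // divr_gt0 // subr_gt0.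
rewrite eq_sym gij => /(_ isT isT) /(congr1 (height w)).
rewrite (G_height lo_lo (gG Kj)) heightD heightZ (F_height (fF Kj)) mulr0 addr0.
rewrite height_vertex top_hi => /eqP; rewrite eqr_int => /eqP lohi.
by have := h_max_gt0; rewrite -lohi ltNge ltW // h_min_lt0.
Qed.

(** If all [f i] agreed, take [x] in [F]. Since [g l + m *: x] is in [P], no coordinate of [x] at an
    [l] in [K] exceeds that of [f i1]; outside [K] they agree. Both sets of coordinates sum to 1, so
    [x] is [f i1] and [F] is a point. *)
Let distinct_f : exists i j, [/\ i \in K, j \in K & f i != f j].
Proof.
apply: contrapT => no_ij.
have f_cst i j : i \in K -> j \in K -> f i = f j.
  by move=> Ki Kj; apply: contrapT => /eqP fij; apply: no_ij; exists i, j.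
have [[i1 hz_i1] _] := h_min_vertex.
have Ki1 : i1 \in K by rewrite inE hz_i1.
suff F_pt x : F x -> x = f i1.
  by have [x [x' [/F_pt -> /F_pt -> ]]] := F_nontrivial.
move=> Fx.
have bE l i : i \in K ->
    b l (g i + m *: x) = (l == i)%:R + m * (b l x - b l (f i1)).
  move=> Ki; rewrite -(bary_vertex v_ind) -bary_affine; congr bary.
  by rewrite (gf_sum Ki) (f_cst i i1) //; apply/rowP => k; rewrite !mxE; ring.
have lo_x i : i \in K -> slice w P lo (g i + m *: x).
  by move=> Ki; apply: slice_add => //; exact: gG.
have d_le0 l : b l x - b l (f i1) <= 0.
  have [Kl|Kl] := boolP (l \in K).
    have := bary_le1 l (slice_sub (lo_x l Kl)).2.
    by rewrite bE // eqxx /= gerDl pmulr_rle0.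
  have := bary_slice Kl (lo_x i1 Ki1); rewrite bE //.
  have -> : (l == i1) = false by apply: contraNF Kl => /eqP ->.
  by move/eqP; rewrite add0r mulf_eq0 (gt_eqF m_gt0) /= => /eqP ->.
have /psumr_eq0P d0 : \sum_l (b l (f i1) - b l x) = 0.
  by rewrite sumrB !bary_sum1 // subrr.
rewrite -(bary_sum v_ind x) -[RHS](bary_sum v_ind); apply: eq_bigr => l _.
congr (_ *: _); apply/esym/eqP; rewrite -subr_eq0 d0 // => k _.
by rewrite -oppr_le0 opprB.
Qed.

(** Take [f a] and [f c] distinct, so that [g a = g c]. Any [f l] differs from one of them, which
    forces [g l] to be that common value. *)
Let g_cst i j : i \in K -> j \in K -> g i = g j.
Proof.
have [a [c [Ka Kc fac]]] := distinct_f.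
have gac : g a = g c.
  by have [/eqP|//] := f_eq_or_g_eq Ka Kc; rewrite (negPf fac).
suff gia l : l \in K -> g l = g a by move=> /gia -> /gia ->.
move=> Kl; have [fla|//] := f_eq_or_g_eq Kl Ka.
have [flc|->//] := f_eq_or_g_eq Kl Kc.
by move: fac; rewrite -fla flc eqxx.
Qed.

Lemma mut_simplex_bottom : exists i j,
  [/\ vheight i = lo, vheight j = lo & i != j].
Proof.
have [i [j [Ki Kj fij]]] := distinct_f; exists i, j.
split; [exact: eqP Ki|exact: eqP Kj|].
by apply: contraNneq fij => ->.
Qed.

(** With [g] constant, [v i - v j] is [m] times [f i - f j], and vertices of the lattice polytope
    [F] are lattice points. *)
Lemma mut_simplex_dvd i j : vheight i = lo -> vheight j = lo ->
  lattice_dvd lo (v i - v j).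
Proof.
move=> /eqP Ki /eqP Kj.
have f_int l : l \in K -> exists u, f l = embed u.
  move=> /vert_f; have [[s ->] _ _] := F_factor.
  by move=> /vert_conv[u _ <-]; exists u.
have [ui fi] := f_int i Ki; have [uj fj] := f_int j Kj.
exists (uj - ui); rewrite embedMz embedB -fi -fj (gf_sum Ki) (gf_sum Kj).
rewrite (g_cst Ki Kj) /m rmorphN.
by apply/rowP => l; rewrite !mxE; ring.
Qed.

(** A pair of distinct [f a], [f c] gives parallel edges of the mutation near [v i] and near [v j].
    [vert_simplex] identifies their endpoints; comparing heights and cancelling leaves
    [v i = v j]. *)
Lemma mut_simplex_top i j : 0 < vheight i -> 0 < vheight j -> i = j.
Proof.
move=> hi0 hj0; have [a [c [Ka Kc fac]]] := distinct_f.
have i_gt0 : 0 < (vheight i)%:~R :> rat by rewrite ltr0z.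
have j_gt0 : 0 < (vheight j)%:~R :> rat by rewrite ltr0z.
have cE : v i + (vheight i)%:~R *: f a - (v i + (vheight i)%:~R *: f c) =
    ((vheight i)%:~R / (vheight j)%:~R) *:
    (v j + (vheight j)%:~R *: f a - (v j + (vheight j)%:~R *: f c)).
  rewrite !opprD !(addrACA _ _ (- v _)) !subrr !add0r -!scalerBr scalerA.
  by rewrite divfK ?gt_eqF.
have := @vert_simplex _ _ _ _ _ _ _ mut_simplex (vert_mut_f Ka hi0)
  (vert_mut_f Kc hi0) (vert_mut_f Ka hj0) (vert_mut_f Kc hj0) _ _ cE.
rewrite divr_gt0 // (inj_eq (addrI _)) (inj_eq (scalerI _)) ?gt_eqF // fac.
move=> /(_ isT isT) vfE.
have hij : vheight i = vheight j.
  apply/eqP; rewrite -(eqr_int rat) -!height_vertex; apply/eqP.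
  have := congr1 (height w) vfE.
  by rewrite !heightD !heightZ (F_height (fF Ka)) !mulr0 !addr0.
by apply: (aff_indep_inj v_ind); move: vfE; rewrite hij => /addIr.
Qed.

Lemma mut_simplex_cases i : [\/ vheight i = hi, vheight i = lo | vheight i = 0].
Proof.
have [i0|i0|->] := ltgtP (vheight i) 0; last by apply: Or33.
  have [|i_lo] := eqVneq (vheight i) lo; first by apply: Or32.
  have lh : lo <= vheight i < 0 by rewrite i0 h_min_vertex.2.
  have [x [y [Gx Fy vE]]] := split_vertex lh (erefl _).
  have [a [c [Ka Kc fac]]] := distinct_f.
  have iK : i \notin K by rewrite inE.
  have h_gt0 : 0 < (- vheight i)%:~R / m :> rat.
    by rewrite divr_gt0 // ltr0z oppr_gt0.
  have ylo : slice w P lo (g a + m *: y) by apply: slice_add => //; exact: gG.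
  (* This point of the bottom slice has coordinates of sum 1. For [l] in [K], choose [k] in [K]
     other than [l]: the point [x + (- vheight i)%:~R *: f k] of [P] has a nonnegative coordinate at
     [l], a negative multiple of the one in question. *)
  suff b_le0 l : b l (g a + m *: y) <= 0.
    have := bary_sum1 v_ind (g a + m *: y) => b1.
    have : \sum_l b l (g a + m *: y) <= 0 by apply: sumr_le0.
    by rewrite b1 ler10.
  have [Kl|Kl] := boolP (l \in K); last by rewrite bary_slice.
  have [k Kk lk] : exists2 k, k \in K & l != k.
    have [la|?] := eqVneq l a; last by exists a.
    by exists c; rewrite // la; apply: contraNneq fac => ->.
  have := (inP _).1 (slice_sub (slice_add lh Gx (fF Kk))).2 l.
  have -> : x + (- vheight i)%:~R *: f k =
      v i + ((- vheight i)%:~R / m) *: (v k - (g a + m *: y)).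
    rewrite (gf_sum Kk) (g_cst Kk Ka) opprD addrACA subrr add0r -scalerBr.
    rewrite scalerA divfK ?gt_eqF // vE.
    by apply/rowP => q; rewrite !mxE; ring.
  rewrite bary_affine !bary_vertex // (negPf lk).
  have -> : (l == i) = false by apply: contraNF iK => /eqP <-.
  by rewrite add0r sub0r pmulr_rge0 // oppr_ge0.
have [[j hj] _] := h_max_vertex.
apply: Or31; rewrite -hj (mut_simplex_top i0 _ : i = j) //.
by rewrite hj h_max_gt0.
Qed.

End SimplexMutation.

End LatticeSimplex.

(** A one-point factor always gives a simplex ([mut_point]), so the equivalence concerns factors of
    positive dimension. These require two distinct bottom vertices, whence [1 < k]. The last
    conjunct is the if direction with no restriction on the factor, and so includes [k = 1]. *)
Theorem lemma4p4 (n k : nat) (P : set 'rV[rat]_n) (w : 'cV[int]_n)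
    (v : 'I_n.+1 -> 'rV[rat]_n)
    (P_fano : fano_simplex P) (w_prim : primitive w)
    (v_inj : injective v) (v_vert : vert P = range v)
    (k_le_n : (k <= n)%N)
    (v_bot : slice w P (h_min w P) =
             conv [set v i | i in [set i : 'I_n.+1 | (1 <= i <= k)%N]]) :
  let conditions :=
    [/\ exists2 u, vert P u & slice w P (h_max w P) = [set u],
        forall i : 'I_n.+1, (1 <= i <= k)%N ->
          lattice_dvd (h_min w P) (v i - v (inord 1))
      & forall u, vert P u ->
          height w u <> (h_max w P)%:~R -> height w u <> (h_min w P)%:~R ->
          height w u = 0] in
  ((exists F, [/\ is_factor w P F, nontrivial F & simplex (mut w P F)])
     <-> (1 < k)%N /\ conditions)
  /\
  (conditions -> exists F, is_factor w P F /\ simplex (mut w P F)).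
Proof.
have [PE v_ind [z v_int]] := fano_simplexP P_fano v_vert.
have [[_ _ P_int _] _] := P_fano.
have w_neq0 := primitive_neq0 w_prim.
have w_pos : exists2 x, P x & 0 < height w x.
  have [x Px] := origin_interior_height P_int w_neq0 (oner_neq0 _).
  by rewrite mul1r; exists x.
have w_neg : exists2 x, P x & height w x < 0.
  have [|x Px] := @origin_interior_height _ _ _ (-1) P_int w_neq0.
    by rewrite oppr_eq0 oner_eq0.
  by rewrite mulN1r oppr_gt0; exists x.
have hE := height_vertex w v_int.
have hi_gt0 := h_max_gt0 v_ind PE v_int w_pos.
have height_eq i h : height w (v i) = h%:~R <-> vheight w z i = h.
  by rewrite hE; split=> [/eqP|->//]; rewrite eqr_int => /eqP.
(* A vertex in the hull of [v_1, ..., v_k] is one of them, since its own barycentric coordinate is 1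
   and not 0. *)
have bottom i : vheight w z i = h_min w P <-> (1 <= i <= k)%N.
  split=> [ih|ik].
    have := vertex_slice w PE v_int i; rewrite ih v_bot.
    move=> /(conv_bary_in v_ind [pred i : 'I_n.+1 | (1 <= i <= k)%N])[_ /(_ i)].
    rewrite bary_vertex // eqxx inE; case: (_ <= _ <= _)%N => // /(_ isT)/eqP.
    by rewrite oner_eq0.
  apply/height_eq; have : slice w P (h_min w P) (v i).
    by rewrite v_bot; apply: sub_conv; exists i.
  by case/(slice_sub PE).
have [[top hi_top] _] := h_max_vertex w PE v_int.
have hz_inord (i : nat) : (0 < i)%N -> (i <= k)%N ->
    vheight w z (inord i) = h_min w P.
  move=> i_gt0 ik; apply/bottom.
  by rewrite inordK ?i_gt0 // ltnS (leq_trans ik).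
split; last first.
  by move=> _; exists [set 0]; exact: (mut_point w v_ind PE v_vert v_int).
split=> [[F [F_factor F_nontriv mut_simp]]|[k_gt1 [[u _ top_u] dvd cases]]].
  have [i [j [/bottom ik /bottom jk ij]]] := mut_simplex_bottom
    v_ind PE v_vert v_int w_neg F_factor F_nontriv.
  have k_gt1 : (1 < k)%N.
    rewrite ltnNge; apply: contra ij => k_le1; apply/eqP/val_inj => /=.
    move: ik jk => /andP[i1 ik] /andP[j1 jk].
    have -> : (i : nat) = 1%N by apply/eqP; rewrite eqn_leq i1 (leq_trans ik).
    by apply/esym/eqP; rewrite eqn_leq j1 (leq_trans jk).
  split=> //; split.
  - exists (v top); first by rewrite v_vert; exists top.
    apply/seteqP; split=> [x x_top|_ ->]; last first.
      by rewrite -hi_top; exact: vertex_slice.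
    have top_uniq l : vheight w z l = h_max w P -> l = top.
      move=> hl; apply: (mut_simplex_top v_ind PE v_vert v_int w_neg
        F_factor F_nontriv mut_simp); by rewrite ?hl ?hi_top.
    (* Only the coordinate at [top] can be nonzero on the top slice. *)
    rewrite /= -(bary_sum v_ind x) (bigD1 top) //= big1 ?addr0 => [|l l_top].
      have := bary_sum1 v_ind x; rewrite (bigD1 top) //= big1 ?addr0.
        by move=> ->; rewrite scale1r.
      move=> l l_top; apply: (slice_max_bary v_ind PE v_int x_top).
      by apply: contra l_top => /eqP /top_uniq ->.
    rewrite (slice_max_bary v_ind PE v_int x_top) ?scale0r //.
    by apply: contra l_top => /eqP /top_uniq ->.
  - move=> l /bottom lk.
    apply: (mut_simplex_dvd v_ind PE v_vert v_int w_neg w_pos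
      F_factor F_nontriv mut_simp lk).
    by rewrite hz_inord // ltnW.
  - move=> u; rewrite v_vert => -[l _ <-].
    have [hl|hl|hl] := mut_simplex_cases v_ind PE v_vert v_int w_neg w_pos
      F_factor F_nontriv mut_simp l; rewrite hE hl //.
have dvd' i : exists y : 'rV[int]_n, vheight w z i = h_min w P ->
    v i - v (inord 1) = embed (y *~ h_min w P).
  have [/bottom/dvd[y yE]|?] := pselect (vheight w z i = h_min w P);
    last by exists 0.
  by exists y.
have [y y_dvd] := choice dvd'.
apply: (mutation_simplex v_ind PE v_vert v_int w_neg w_pos hi_top _
  (hz_inord 1 isT (ltnW k_gt1)) (hz_inord 2 isT k_gt1) _ _ y_dvd).
- have slice_top i : vheight w z i = h_max w P -> v i = u.
    by move=> ih; have := vertex_slice w PE v_int i; rewrite ih top_u.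
  by move=> i /slice_top vi; apply: v_inj; rewrite vi slice_top.
- apply/eqP => /(congr1 val) /=; rewrite !inordK ?ltnS //;
    last exact: leq_trans k_gt1 k_le_n.
  exact: leq_trans (ltnW k_gt1) k_le_n.
- move=> i; have [?|hi] := pselect (vheight w z i = h_max w P);
    first exact: Or31.
  have [?|lo] := pselect (vheight w z i = h_min w P); first exact: Or32.
  apply/Or33/height_eq; apply: cases; rewrite ?v_vert; first by exists i.
    by move/height_eq.
  by move/height_eq.
Qed.
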